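(* If $G$ is a positive definite block Hankel matrix with entries $g_{ij}=h_{i+j}\in\mathbb{C}^{p\times p}$ for $i,j=0,\ldots,n$, if $\alpha$ is any point in $\mathbb{C}_+$, if $$E_+(\lambda)=\rho_\alpha(\lambda)F(\lambda)\Gamma F(\alpha)^*\,(\rho_\alpha(\alpha)F(\alpha)\Gamma F(\alpha)^* )^{-1/2},$$ and if $\Delta_{\mathfrak{E}}(\mu)=(E_+(\mu)E_+(\mu)^* )^{-1}$ for $\mu\in\mathbb{R}$, then $$\int_{-\infty}^\infty\mu^k\Delta_{\mathfrak{E}}(\mu)\,d\mu=h_k\quad\text{for } k=0,\ldots,2n.$$ Thus, $\sigma(\mu)=\int_{-\infty}^\mu\Delta_{\mathfrak{E}}(x)\,dx$ is a solution of the truncated Hamburger matrix moment problem for $h_0,\ldots,h_{2n}$.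
   Context: $\mathbb{C}_+$ is the open upper half-plane. $p,n\ge1$ are fixed integers, $F(\lambda)=\begin{bmatrix}I_p&\lambda I_p&\cdots&\lambda^nI_p\end{bmatrix}$, $\Gamma=G^{-1}$, and $\rho_\omega(\lambda)=-2\pi i(\lambda-\overline{\omega})$. A nondecreasing $p\times p$ matrix valued function $\sigma$ on $\mathbb{R}$ is a solution of the truncated matrix Hamburger moment problem for $h_0,\ldots,h_{2n}$ if $\int_{-\infty}^\infty\mu^k\,d\sigma(\mu)=h_k$ for $k=0,\ldots,2n$. *)

(* Defs.v *)
From HB Require Import structures.
From mathcomp Require Import all_boot all_order all_algebra sesquilinear spectral.
From mathcomp Require Import all_classical all_reals all_analysis.
From mathcomp Require Import complex.
Set Implicit Arguments.
Unset Strict Implicit.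
Unset Printing Implicit Defensive.
Import Order.TTheory GRing.Theory Num.Theory.
Local Open Scope ring_scope.
Local Open Scope sesquilinear_scope.

Definition psdmx (C : numClosedFieldType) (m : nat) (A : 'M[C]_m) : Prop :=
  A \is hermsymmx /\ forall v : 'cV[C]_m, 0 <= (v^t* *m A *m v) 0 0.

Definition posdefmx (C : numClosedFieldType) (m : nat) (A : 'M[C]_m) : Prop :=
  A \is hermsymmx /\
  forall v : 'cV[C]_m, v != 0 -> 0 < (v^t* *m A *m v) 0 0.

(* [A ^ (-1/2)] by functional calculus in an orthonormal eigenbasis; [mx_rsqrtP]
   below shows that for positive definite [A] it is a positive definite square
   root of [A^-1]. *)
Definition mx_rsqrt (C : numClosedFieldType) (m : nat) (A : 'M[C]_m) : 'M[C]_m :=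
  invmx (spectralmx A)
    *m diag_mx (map_mx (fun x => (sqrtC x)^-1) (spectral_diag A))
    *m spectralmx A.

Lemma posdefmx_unitary_diag (C : numClosedFieldType) m (P : 'M[C]_m)
    (d : 'rV[C]_m) :
  P \is unitarymx ->
  posdefmx (P^t* *m diag_mx d *m P) <-> (forall i, 0 < d 0 i).
Proof.
move=> Pu; have PPt : P *m P^t* = 1%:M by apply/unitarymxP.
have Punit := unitarymx_unit Pu.
have PtP : P^t* *m P = 1%:M by rewrite -invmx_unitary// mulVmx.
have qE (v : 'cV[C]_m) : (v^t* *m (P^t* *m diag_mx d *m P) *m v) 0 0 =
    \sum_i d 0 i * `|(P *m v) i 0| ^+ 2.
  have -> : v^t* *m (P^t* *m diag_mx d *m P) *m v =
            (P *m v)^t* *m (diag_mx d *m (P *m v)).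
    by rewrite trmx_mul map_mxM !mulmxA.
  rewrite mxE; apply: eq_bigr => i _; rewrite mul_diag_mx !mxE normCK.
  by rewrite mulrCA [_^* * _]mulrC.
split=> [[_ pd] i|d0].
  have /pd : P^t* *m delta_mx i 0 != 0 :> 'cV_m.
    apply/eqP => /(congr1 (mulmx P)); rewrite mulmxA PPt mul1mx mulmx0.
    by move=> /matrixP /(_ i 0)/eqP; rewrite !mxE !eqxx oner_eq0.
  rewrite qE mulmxA PPt mul1mx (bigD1 i)//= big1 => [|j ji].
    by rewrite mxE !eqxx normr1 expr1n mulr1 addr0.
  by rewrite mxE (negPf ji) normr0 expr0n mulr0.
split=> [|v v0].
  apply/is_hermitianmxP; rewrite expr0 scale1r.
  rewrite !trmx_mul !map_mxM trmxCK tr_diag_mx map_diag_mx /= -mulmxA.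
  congr (_ *m _); congr (diag_mx _ *m _).
  by apply/rowP => i; rewrite mxE; apply/esym/CrealP/gtr0_real.
rewrite qE lt_neqAle eq_sym psumr_neq0; last first.
  by move=> i _; rewrite mulr_ge0 ?exprn_ge0// ltW.
rewrite sumr_ge0 ?andbT; last first.
  by move=> i _; rewrite mulr_ge0 ?exprn_ge0// ltW.
have : P *m v != 0.
  by apply: contraNneq v0 => Pv; rewrite -[v]mul1mx -PtP -mulmxA Pv mulmx0.
apply: contra_neqT => /hasPn nex; apply/colP => i; rewrite [RHS]mxE.
have /= := nex i (mem_index_enum i).
rewrite pmulr_rgt0// -normrX normr_gt0 negbK expf_eq0 => /andP[_] /eqP //.
Qed.

Lemma mx_rsqrtP (C : numClosedFieldType) m (A : 'M[C]_m) : posdefmx A ->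
  posdefmx (mx_rsqrt A) /\ mx_rsqrt A *m mx_rsqrt A = invmx A.
Proof.
move=> pA; have [hA _] := pA.
have Pu := spectral_unitarymx A; have Punit := spectral_unit A.
have AE := orthomx_spectralP (hermitian_normalmx hA).
have d0 i : 0 < spectral_diag A 0 i.
  by move: i; apply/(posdefmx_unitary_diag _ Pu); rewrite -invmx_unitary// -AE.
split.
  rewrite /mx_rsqrt invmx_unitary//; apply/posdefmx_unitary_diag => // i.
  by rewrite mxE invr_gt0 sqrtC_gt0.
have dd : A *m (mx_rsqrt A *m mx_rsqrt A) = 1%:M.
  rewrite {1}AE /mx_rsqrt !mulmxA !(mulmxK Punit) -!(mulmxA (invmx _)).
  rewrite !mulmx_diag [X in diag_mx X](_ : _ = const_mx 1).
    by rewrite diag_const_mx mul1mx mulVmx.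
  apply/rowP => i; rewrite !mxE -mulrA -invfM -expr2 sqrtCK divff//.
  by rewrite gt_eqF.
have Au : A \in unitmx by have [] := mulmx1_unit dd.
by rewrite -[LHS](mulKmx Au) dd mulmx1.
Qed.

Definition hankel (V : nmodType) (p n : nat) (h : nat -> 'M[V]_p) :
    'M[V]_(\sum_(i < n.+1) p, \sum_(j < n.+1) p) :=
  \mxblock_(i < n.+1, j < n.+1) h (i + j)%N.

Definition Frow (C : nzRingType) (p n : nat) (lambda : C) :
    'M[C]_(p, \sum_(j < n.+1) p) :=
  \mxrow_(j < n.+1) (lambda ^+ j)%:M.

Section Kernel.
Variable R : realType.

Definition rho (omega lambda : R[i]) : R[i] :=
  - (2 * (pi : R)%:C%C * 'i * (lambda - omega^*)).

Variables (p n : nat) (G : 'M[R[i]]_(\sum_(i < n.+1) p, \sum_(j < n.+1) p)).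
Variable alpha : R[i].

Definition Eplus (lambda : R[i]) : 'M[R[i]]_p :=
  rho alpha lambda *: (Frow p n lambda *m invmx G *m (Frow p n alpha)^t*)
    *m mx_rsqrt
         (rho alpha alpha *: (Frow p n alpha *m invmx G *m (Frow p n alpha)^t*)).

Definition DeltaE (mu : R) : 'M[R[i]]_p :=
  invmx (Eplus mu%:C%C *m (Eplus mu%:C%C)^t*).

End Kernel.

Section MatrixIntegral.
Variables (R : realType) (p : nat).
Implicit Types (D : set R) (F sigma : R -> 'M[R[i]]_p) (f : R -> R).

Definition mx_integrable D F : Prop := forall i j,
  (@lebesgue_measure R).-integrable D (EFin \o (fun x => complex.Re (F x i j))) /\
  (@lebesgue_measure R).-integrable D (EFin \o (fun x => complex.Im (F x i j))).

(* As for [Rintegral], meaningful only under [mx_integrable D F]. *)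
Definition mx_integral D F : 'M[R[i]]_p := \matrix_(i, j)
  Complex (Rintegral (@lebesgue_measure R) D (fun x => complex.Re (F x i j)))
          (Rintegral (@lebesgue_measure R) D (fun x => complex.Im (F x i j))).

Definition mx_nondecreasing sigma : Prop :=
  forall a b : R, a <= b -> psdmx (sigma b - sigma a).

Definition mx_close (e : R) (A B : 'M[R[i]]_p) : Prop :=
  forall i j, `|A i j - B i j| < e%:C%C.

(* The integral against a matrix valued [sigma] is the Riemann-Stieltjes one, so
   no normalization of [sigma] at its jumps is needed. [a :: s] lists the
   points of the partition and [t k] is the tag of its [k]-th interval. *)
Definition rs_sum f sigma (a : R) (s : seq R) (t : nat -> R) : 'M[R[i]]_p :=
  \sum_(k < size s) (f (t k))%:C%C *: (sigma s`_k - sigma (a :: s)`_k).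

Definition is_rs_integral f sigma (a b : R) (M : 'M[R[i]]_p) : Prop :=
  forall e : R, 0 < e -> exists2 d : R, 0 < d &
    forall (s : seq R) (t : nat -> R), itv_partition a b s ->
      (forall k, (k < size s)%N ->
         s`_k - (a :: s)`_k < d /\ (a :: s)`_k <= t k <= s`_k) ->
      mx_close e (rs_sum f sigma a s t) M.

(* Over the whole line: the double limit as [a --> -oo] and [b --> +oo]. *)
Definition is_rs_integral_line f sigma (M : 'M[R[i]]_p) : Prop :=
  exists I : R -> R -> 'M[R[i]]_p,
    (forall a b, a < b -> is_rs_integral f sigma a b (I a b)) /\
    forall e : R, 0 < e -> exists N : R, forall a b : R,
      a < - N -> N < b -> a < b -> mx_close e (I a b) M.

Definition hamburger_solution (n : nat) (h : nat -> 'M[R[i]]_p) sigma : Prop :=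
  mx_nondecreasing sigma /\
  forall k, (k <= 2 * n)%N -> is_rs_integral_line (fun mu => mu ^+ k) sigma (h k).

End MatrixIntegral.

(* Main.v *)
Require Import Defs.
From mathcomp Require Import all_boot all_order all_algebra perm sesquilinear spectral.
From mathcomp Require Import all_classical all_reals all_analysis.
From mathcomp Require Import measurable_realfun.
From mathcomp Require Import complex ring lra zify.
Set Implicit Arguments.
Unset Strict Implicit.
Unset Printing Implicit Defensive.
Import Order.TTheory GRing.Theory Num.Theory.
Import numFieldNormedType.Exports.
Local Open Scope ring_scope.
Local Open Scope classical_set_scope.
Local Open Scope sesquilinear_scope.

(** Write [A(z) = F(z) Gamma F(alpha)^*].  The number [rho_alpha(alpha)] is
    positive, and cancelling the square root in [E_+ E_+^*] gives
    [Delta(x) = P(x) A(x)^-* A(alpha) A(x)^-1], where [P] is the Poisson kernel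
    of the upper half-plane at [alpha] ([DeltaE_eq]).

    Because [G] is a Hankel matrix, multiplication by [z] is symmetric for the
    inner product that [G] defines on vector polynomials.  A singular value
    [A(lambda)] with [lambda] on or above the real axis would produce
    polynomials [(z - lambda) g] and [(z - alpha) g] orthogonal to each other,
    which symmetry and positivity forbid ([hform_XsubC_neq0], [kernel_unit]);
    in the same way the coefficient of [z^n] in [A] is invertible
    ([kernel_coef_unit]).  So [A^-1] is holomorphic above the axis and of order
    [z^-n] at infinity, which makes [x^k Delta(x)] integrable for [k <= 2n].

    Since [Delta(x) A(x) = P(x) A(x)^-* A(alpha)], the Poisson formula
    ([poisson_formula]) evaluates the integral of [x^i Delta(x) A(x)] for
    [i <= n]: it is [conj(alpha)^i] times the identity ([Delta_moment_kernel]).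
    The same relation with [h_k] in place of the moments of [Delta] is
    [G Gamma = 1] read by blocks ([hankel_kernel_coef]).  Hence the difference
    [D_k] of the two sequences is annihilated by [A] on the right and, being
    hermitian, by the adjoint of [A] on the left.  Continued by the recurrence
    that [A] defines, it is annihilated by [det A] and by its conjugate
    polynomial, whose zeros lie below and above the axis respectively; these
    polynomials are coprime, so [D = 0] ([moments_vanish]).

    The Poisson formula is needed only for rational functions.  It follows
    from partial fractions: powers of [1 / (x - w)] above the first have
    rational primitives, and for the first power the principal value is
    computed with a logarithm and an arctangent ([pv_ratio]).

    Finally, any positive hermitian density whose moments are [h_k] gives a
    nondecreasing primitive whose Riemann-Stieltjes sums differ from the
    Lebesgue integrals by the oscillation of [x^k] on the mesh times the total
    mass ([stieltjes_sum_bound], [density_hamburger_solution]). *)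

(** * Integration of complex valued functions of a real variable *)

Section ComplexIntegral.
Variable R : realType.
Implicit Types (D E : set (measurableTypeR R)) (f g : R -> R[i]) (c z : R[i]).
Local Notation mu := (@lebesgue_measure R).
Local Notation Re := (@complex.Re R).
Local Notation Im := (@complex.Im R).

Definition cintegrable D f : Prop :=
  mu.-integrable D (EFin \o (fun x => Re (f x))) /\
  mu.-integrable D (EFin \o (fun x => Im (f x))).

(** The entries of [mx_integral] are of this form by unfolding. *)
Definition cint D f : R[i] :=
  Complex (Rintegral mu D (fun x => Re (f x)))
          (Rintegral mu D (fun x => Im (f x))).

Lemma cReD z c : Re (z + c) = Re z + Re c. Proof. by case: z; case: c. Qed.
Lemma cImD z c : Im (z + c) = Im z + Im c. Proof. by case: z; case: c. Qed.
Lemma cReM z c : Re (z * c) = Re z * Re c - Im z * Im c.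
Proof. by case: z; case: c. Qed.
Lemma cImM z c : Im (z * c) = Re z * Im c + Im z * Re c.
Proof. by case: z; case: c. Qed.
Lemma cReV z : Re z^-1 = Re z / (Re z ^+ 2 + Im z ^+ 2).
Proof. by case: z. Qed.
Lemma cImV z : Im z^-1 = - Im z / (Re z ^+ 2 + Im z ^+ 2).
Proof. by case: z => a b; rewrite [LHS]/= mulNr. Qed.
Lemma cReJ z : Re z^* = Re z. Proof. by case: z. Qed.
Lemma cImJ z : Im z^* = - Im z. Proof. by case: z. Qed.
Lemma ReImP z c : Re z = Re c -> Im z = Im c -> z = c.
Proof. by case: z; case: c => ? ? ? ? /= -> ->. Qed.
Lemma normc2_gt0 z : z != 0 -> 0 < Re z ^+ 2 + Im z ^+ 2.
Proof.
move=> z0; rewrite lt_neqAle addr_ge0 ?sqr_ge0// andbT eq_sym.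
rewrite paddr_eq0 ?sqr_ge0// !sqrf_eq0; apply: contra z0.
by case: z => a b /= /andP[/eqP -> /eqP ->].
Qed.

Lemma cintegrableS D E f : measurable D -> measurable E -> E `<=` D ->
  cintegrable D f -> cintegrable E f.
Proof.
by move=> mD mE ED [h1 h2]; split; [apply: integrableS h1|apply: integrableS h2].
Qed.

Lemma eq_cintegrable D f g : measurable D -> (forall x, D x -> f x = g x) ->
  cintegrable D f -> cintegrable D g.
Proof.
move=> mD fg [h1 h2]; split; [apply: eq_integrable h1|apply: eq_integrable h2] => //.
- by move=> x; rewrite inE /= => /fg ->.
- by move=> x; rewrite inE /= => /fg ->.
Qed.

Lemma eq_cint D f g : (forall x, D x -> f x = g x) -> cint D f = cint D g.
Proof.
by move=> fg; congr Complex; apply: eq_Rintegral => x; rewrite inE => /fg ->.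
Qed.

Lemma cintegrableD D f g : measurable D -> cintegrable D f -> cintegrable D g ->
  cintegrable D (fun x => f x + g x).
Proof.
move=> mD [f1 f2] [g1 g2]; split.
- by apply: (eq_integrable mD _ _ _ (integrableD mD f1 g1)) => x _; rewrite /= cReD.
- by apply: (eq_integrable mD _ _ _ (integrableD mD f2 g2)) => x _; rewrite /= cImD.
Qed.

Lemma cintD D f g : measurable D -> cintegrable D f -> cintegrable D g ->
  cint D (fun x => f x + g x) = cint D f + cint D g.
Proof.
move=> mD [f1 f2] [g1 g2]; rewrite /cint.
under eq_Rintegral do rewrite cReD.
under [in X in Complex _ X]eq_Rintegral do rewrite cImD.
by rewrite !RintegralD.
Qed.

Lemma cintegrableZ D c f : measurable D -> cintegrable D f ->
  cintegrable D (fun x => c * f x).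
Proof.
move=> mD [f1 f2]; split.
- have h1 := integrableZl mD (Re c) f1.
  have h2 := integrableZl mD (Im c) f2.
  by apply: (eq_integrable mD _ _ _ (integrableB mD h1 h2)) => x _; rewrite /= cReM.
- have h1 := integrableZl mD (Re c) f2.
  have h2 := integrableZl mD (Im c) f1.
  by apply: (eq_integrable mD _ _ _ (integrableD mD h1 h2)) => x _; rewrite /= cImM.
Qed.

Lemma cintZ D c f : measurable D -> cintegrable D f ->
  cint D (fun x => c * f x) = c * cint D f.
Proof.
move=> mD [f1 f2]; apply: ReImP; rewrite ?cReM ?cImM /=.
- under eq_Rintegral do rewrite cReM.
  rewrite RintegralB ?RintegralZl//.
  + exact: (integrableZl mD (Re c) f1).
  + exact: (integrableZl mD (Im c) f2).
- under eq_Rintegral do rewrite cImM.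
  rewrite RintegralD ?RintegralZl//.
  + exact: (integrableZl mD (Re c) f2).
  + exact: (integrableZl mD (Im c) f1).
Qed.

Lemma cintegrable0 D : measurable D -> cintegrable D (fun=> 0).
Proof. by move=> mD; split; apply: integrable0. Qed.

Lemma cint0 D : measurable D -> cint D (fun=> 0) = 0.
Proof.
by move=> mD; rewrite /cint/= Rintegral_cst// mul0r.
Qed.

Lemma cintegrable_sum D I (s : seq I) (F : I -> R -> R[i]) : measurable D ->
  (forall i, cintegrable D (F i)) -> cintegrable D (fun x => \sum_(i <- s) F i x).
Proof.
move=> mD hF; elim: s => [|i s IH].
  by apply: eq_cintegrable (cintegrable0 mD) => // x _; rewrite big_nil.
apply: eq_cintegrable (cintegrableD mD (hF i) IH) => // x _.
by rewrite big_cons.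
Qed.

Lemma cint_sum D I (s : seq I) (F : I -> R -> R[i]) : measurable D ->
  (forall i, cintegrable D (F i)) ->
  cint D (fun x => \sum_(i <- s) F i x) = \sum_(i <- s) cint D (F i).
Proof.
move=> mD hF; elim: s => [|i s IH].
  rewrite big_nil -[RHS](cint0 mD); apply: eq_cint => x _.
  by rewrite big_nil.
rewrite big_cons -IH -cintD//; last exact: cintegrable_sum.
by apply: eq_cint => x _; rewrite big_cons.
Qed.

Lemma cint_conj D f : measurable D -> cintegrable D f ->
  cint D (fun x => (f x)^*) = (cint D f)^*.
Proof.
move=> mD [f1 f2]; apply: ReImP; rewrite ?cReJ ?cImJ /=.
- by apply: eq_Rintegral => x _; rewrite cReJ.
- rewrite -mulN1r -RintegralZl//; apply: eq_Rintegral => x _.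
  by rewrite cImJ mulN1r.
Qed.

Lemma cint_ge0 D f : (forall x, D x -> 0 <= f x) -> 0 <= cint D f.
Proof.
move=> f0; rewrite lecE /=; apply/andP; split.
  apply/eqP; rewrite (_ : Rintegral _ _ _ = Rintegral mu D (fun=> 0)).
    by rewrite /Rintegral integral0.
  by apply: eq_Rintegral => x; rewrite inE => /f0/ger0_Im.
by apply: Rintegral_ge0 => x /f0; rewrite lecE => /andP[].
Qed.

(** Continuity of complex valued functions of a real variable is taken
    componentwise, so that it feeds the real integration theory directly. *)
Definition ccont f : Prop :=
  continuous (fun x => Re (f x)) /\ continuous (fun x => Im (f x)).

Lemma ccont_cst c : ccont (fun=> c).
Proof. by split => x; exact: cvg_cst. Qed.

Lemma ccont_id : ccont (fun x : R => x%:C%C).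
Proof. by split => x; [exact: cvg_id|exact: cvg_cst]. Qed.

Lemma ccontD f g : ccont f -> ccont g -> ccont (fun x => f x + g x).
Proof.
move=> [f1 f2] [g1 g2]; split => x.
- by under eq_fun do rewrite cReD; apply: cvgD; [apply: f1|apply: g1].
- by under eq_fun do rewrite cImD; apply: cvgD; [apply: f2|apply: g2].
Qed.

Lemma ccontM f g : ccont f -> ccont g -> ccont (fun x => f x * g x).
Proof.
move=> [f1 f2] [g1 g2]; split => x.
- under eq_fun do rewrite cReM; apply: cvgB; apply: cvgM;
  [exact: f1|exact: g1|exact: f2|exact: g2].
- under eq_fun do rewrite cImM; apply: cvgD; apply: cvgM;
  [exact: f1|exact: g2|exact: f2|exact: g1].
Qed.

Lemma ccontV f : (forall x, f x != 0) -> ccont f -> ccont (fun x => (f x)^-1).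
Proof.
move=> f0 [f1 f2].
have h (x : R) : ((Re (f t) ^+ 2 + Im (f t) ^+ 2)^-1 @[t --> x]
    --> (Re (f x) ^+ 2 + Im (f x) ^+ 2)^-1).
  apply: cvgV; first by rewrite gt_eqF// normc2_gt0.
  by apply: cvgD; apply: cvgM; try exact: f1; exact: f2.
split => x.
- by under eq_fun do rewrite cReV; apply: cvgM; [apply: f1|apply: h].
- under eq_fun do rewrite cImV; apply: cvgM; [apply: cvgN; apply: f2|apply: h].
Qed.

Lemma ccont_horner (p : {poly R[i]}) : ccont (fun x : R => p.[x%:C%C]).
Proof.
elim/poly_ind: p => [|p c IH].
  by under eq_fun do rewrite horner0; exact: ccont_cst.
under eq_fun do rewrite hornerMXaddC.
by apply: ccontD; [apply: ccontM IH ccont_id|exact: ccont_cst].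
Qed.

Lemma ccont_ratio (q d : {poly R[i]}) : (forall x : R, d.[x%:C%C] != 0) ->
  ccont (fun x : R => q.[x%:C%C] / d.[x%:C%C]).
Proof.
move=> d0; apply: ccontM; first exact: ccont_horner.
by apply: ccontV => //; exact: ccont_horner.
Qed.

Lemma ccont_integrable f (a b : R) : ccont f -> cintegrable `[a, b] f.
Proof.
by move=> [f1 f2]; split; apply: continuous_compact_integrable;
  try exact: segment_compact; exact: continuous_subspaceT.
Qed.

Lemma normcE_Re_Im z : `|z| = (Num.sqrt (Re z ^+ 2 + Im z ^+ 2))%:C%C.
Proof. by case: z. Qed.

Lemma normr_Re z : (`|Re z|)%:C%C <= `|z|.
Proof. exact: normc_ge_Re. Qed.

Lemma normr_Im z : (`|Im z|)%:C%C <= `|z|.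
Proof.
by case: z => a b; rewrite normcE_Re_Im lecR /= -sqrtr_sqr ler_wsqrtr// lerDr sqr_ge0.
Qed.

End ComplexIntegral.

(** * Growth of polynomials on the real line *)

Section RationalBounds.
Variable R : realType.
Implicit Types (q d : {poly R[i]}) (w : R[i]) (x : R).
Local Notation mu := (@lebesgue_measure R).
Local Notation Re := (@complex.Re R).
Local Notation Im := (@complex.Im R).
Local Notation s x := (Num.sqrt (oneDsqr (x : R))).

Lemma sqrt_oneDsqr_ge1 x : 1 <= s x.
Proof. by rewrite -[leLHS]sqrtr1 ler_wsqrtr// oneDsqr_ge1. Qed.

Lemma norm_le_sqrt_oneDsqr x : `|x| <= s x.
Proof. by rewrite -sqrtr_sqr ler_wsqrtr// /oneDsqr lerDr. Qed.

Lemma normc_real x : `|x%:C%C| = (`|x|)%:C%C :> R[i].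
Proof. by rewrite normcE_Re_Im /= expr0n addr0 sqrtr_sqr. Qed.

Lemma Re_normc (z : R[i]) : (complex.Re `|z|)%:C%C = `|z|.
Proof. by rewrite RRe_real// ger0_real. Qed.

(** The weight [sqrt (1 + x^2)] is used instead of [|x|] because it is at least
    1: its highest power then dominates all the others. *)
Lemma horner_growth q (m : nat) : (size q <= m.+1)%N ->
  exists2 C : R, 0 <= C & forall x, `|q.[x%:C%C]| <= (C * s x ^+ m)%:C%C.
Proof.
move=> sq; exists (\sum_(i < size q) complex.Re `|q`_i|).
  by apply: sumr_ge0 => i _; rewrite -lecR Re_normc normr_ge0.
move=> x; rewrite horner_coef (le_trans (ler_norm_sum _ _ _))//.
rewrite mulr_suml rmorph_sum /=; apply: ler_sum => i _.
rewrite rmorphM /= Re_normc normrM ler_wpM2l// normrX normc_real.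
rewrite -rmorphXn lecR (@le_trans _ _ (s x ^+ i))//.
  by apply: lerXn2r; rewrite ?nnegrE// ?sqrtr_ge0// norm_le_sqrt_oneDsqr.
by rewrite ler_weXn2l ?sqrt_oneDsqr_ge1// -ltnS (leq_trans (ltn_ord i)).
Qed.

(** With [w = u + iv] and [S = 1 + u^2 + v^2] the constant is [|v| / sqrt S]:
    the polynomial [S |x - w|^2 - v^2 (1 + x^2)] in [x] is nonnegative, since
    it becomes a sum of two squares once multiplied by [1 + u^2]. *)
Lemma XsubC_growth w : Im w != 0 ->
  exists2 c : R, 0 < c & forall x, (c * s x)%:C%C <= `|x%:C%C - w|.
Proof.
case: w => u v /= v0; set S := 1 + u ^+ 2 + v ^+ 2.
have v2 : 0 < v ^+ 2 by rewrite exprn_even_gt0.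
have u1 : 0 < 1 + u ^+ 2 by rewrite ltr_pwDl// sqr_ge0.
have S0 : 0 < S by rewrite ltr_wpDr// ltW.
exists (Num.sqrt (v ^+ 2 / S)) => [|x]; first by rewrite sqrtr_gt0 divr_gt0.
rewrite -sqrtrM ?divr_ge0 ?(ltW v2) ?(ltW S0)// normcE_Re_Im lecR ler_wsqrtr//=.
rewrite sub0r sqrrN mulrAC ler_pdivrMr// -subr_ge0 -(pmulr_rge0 _ u1).
rewrite (_ : _ * _ = ((1 + u ^+ 2) * x - u * S) ^+ 2 + (v ^+ 2) ^+ 2).
  by rewrite addr_ge0// sqr_ge0.
by rewrite /oneDsqr /S; ring.
Qed.

(** Over the complex numbers [d] is a product of linear factors, each of which
    grows like the weight because no root is real. *)
Lemma horner_lower d : (forall x, d.[x%:C%C] != 0) ->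
  exists2 c : R, 0 < c &
    forall x, (c * s x ^+ (size d).-1)%:C%C <= `|d.[x%:C%C]|.
Proof.
move=> dN0; have [r dE] := closed_field_poly_normal d.
have d0 : d != 0 by apply: contraNneq (dN0 0) => ->; rewrite horner0.
have -> : (size d).-1 = size r.
  by rewrite dE size_scale ?lead_coef_eq0// size_prod_XsubC.
have rN0 w : w \in r -> Im w != 0.
  move=> wr; apply/negP => /eqP w0; have := dN0 (Re w).
  have -> : (Re w)%:C%C = w by case: w w0 {wr} => ? ? /= ->.
  by rewrite dE hornerZ (rootP _) ?mulr0 ?eqxx// root_prod_XsubC.
have [c c0 H] : exists2 c : R, 0 < c & forall x,
    (c * s x ^+ size r)%:C%C <= `|(\prod_(z <- r) ('X - z%:P)).[x%:C%C]|.
  elim: {dE} r rN0 => [|w r IH] rN0.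
    by exists 1 => // x; rewrite big_nil hornerC normr1 expr0 mulr1.
  have [|c c0 Hc] := IH; first by move=> z zr; rewrite rN0// in_cons zr orbT.
  have [e e0 He] := XsubC_growth (rN0 w (mem_head _ _)).
  exists (e * c) => [|x]; first exact: mulr_gt0.
  rewrite big_cons hornerM normrM hornerXsubC exprS mulrACA rmorphM /=.
  by apply: ler_pM => //; rewrite ler0c !mulr_ge0 ?sqrtr_ge0 ?ltW// exprn_gt0//
    (lt_le_trans _ (sqrt_oneDsqr_ge1 x)).
exists (Re `|lead_coef d| * c) => [|x].
  by rewrite mulr_gt0// -ltcR Re_normc normr_gt0 lead_coef_eq0.
rewrite -mulrA rmorphM /= Re_normc [in leRHS]dE hornerZ normrM.
by rewrite ler_wpM2l.
Qed.

(** A gap of two between the degrees makes a quotient integrable on the line. *)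
Lemma ratio_decay q d : (forall x, d.[x%:C%C] != 0) ->
  (size q + 2 <= size d)%N ->
  exists2 C : R, 0 <= C &
    forall x, `|q.[x%:C%C] / d.[x%:C%C]| <= (C * (oneDsqr x)^-1)%:C%C.
Proof.
move=> dN0 qd; have [->|q0] := eqVneq q 0.
  by exists 0 => // x; rewrite horner0 mul0r normr0 mul0r.
have [m sd] : exists m, size d = m.+3.
  exists (size d - 3)%N; move: qd (q0); rewrite -size_poly_gt0; lia.
have [c c0 Hc] := horner_lower dN0.
have [|C C0 HC] := @horner_growth q m; first by rewrite sd in qd; lia.
exists (C / c) => [|x]; first by rewrite divr_ge0// ltW.
rewrite normrM normfV ler_pdivrMr ?normr_gt0//.
apply: le_trans (HC x) _.
have sx : 0 < s x := lt_le_trans ltr01 (sqrt_oneDsqr_ge1 x).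
have CE : C * s x ^+ m = (C / c * (oneDsqr x)^-1) * (c * s x ^+ (size d).-1).
  have : oneDsqr x = s x ^+ 2.
    by rewrite sqr_sqrtr// (le_trans _ (oneDsqr_ge1 x)).
  move: (s x) sx => t t0 ->; rewrite sd -[m.+3.-1]/(2 + m)%N exprD.
  by field; rewrite !gt_eqF.
by rewrite CE rmorphM /= ler_wpM2l// ler0c mulr_ge0 ?invr_ge0 ?divr_ge0 ?(ltW c0)//.
Qed.

Lemma integrable_oneDsqrV : mu.-integrable [set: R] (EFin \o (fun x => (oneDsqr x)^-1)).
Proof.
have c := @continuous_oneDsqrV R.
have p x : 0 <= (oneDsqr x)^-1 by rewrite invr_ge0 (le_trans _ (oneDsqr_ge1 x)).
apply/integrableP; split.
  by apply/measurable_EFinP; exact: continuous_measurable_fun.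
under eq_integral => x _ do rewrite /= ger0_norm//.
rewrite ge0_symfun_integralT//; last by move=> x; rewrite /= /oneDsqr sqrrN.
by rewrite -set_itvcy integral0y_oneDsqr -EFinM ltry.
Qed.

Lemma decay_cintegrable (f : R -> R[i]) (C : R) : 0 <= C -> ccont f ->
  (forall x, `|f x| <= (C * (oneDsqr x)^-1)%:C%C) -> cintegrable [set: R] f.
Proof.
move=> C0 [c1 c2] fC.
have i0 := integrableZl measurableT C integrable_oneDsqrV.
have p x : 0 <= C * (oneDsqr x)^-1.
  by rewrite mulr_ge0// invr_ge0 (le_trans _ (oneDsqr_ge1 x)).
split; apply: (le_integrable measurableT _ _ i0).
- by apply/measurable_EFinP; exact: continuous_measurable_fun.
- move=> x _ /=; rewrite lee_fin [leRHS]ger0_norm// -lecR.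
  exact: le_trans (normr_Re _) (fC x).
- by apply/measurable_EFinP; exact: continuous_measurable_fun.
- move=> x _ /=; rewrite lee_fin [leRHS]ger0_norm// -lecR.
  exact: le_trans (normr_Im _) (fC x).
Qed.

Lemma ratio_cintegrable q d : (forall x, d.[x%:C%C] != 0) ->
  (size q + 2 <= size d)%N ->
  cintegrable [set: R] (fun x => q.[x%:C%C] / d.[x%:C%C]).
Proof.
move=> dN0 qd; have [C C0 H] := ratio_decay dN0 qd.
by apply: decay_cintegrable C0 (ccont_ratio _ dN0) H.
Qed.

End RationalBounds.

(** * Principal values and primitives *)

Section ComplexLimits.
Variable R : realType.
Implicit Types (u v : nat -> R[i]) (f g : R -> R[i]) (c l w : R[i]).
Local Notation mu := (@lebesgue_measure R).
Local Notation Re := (@complex.Re R).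
Local Notation Im := (@complex.Im R).

Definition ccvg u l : Prop :=
  ((fun k => Re (u k)) @ \oo --> Re l) /\ ((fun k => Im (u k)) @ \oo --> Im l).

Lemma ccvg_cst c : ccvg (fun=> c) c.
Proof. by split; exact: cvg_cst. Qed.

Lemma ccvgD u v l c : ccvg u l -> ccvg v c -> ccvg (fun k => u k + v k) (l + c).
Proof.
move=> [u1 u2] [v1 v2]; split.
- by rewrite cReD; under eq_fun do rewrite cReD; exact: cvgD.
- by rewrite cImD; under eq_fun do rewrite cImD; exact: cvgD.
Qed.

Lemma ccvgM u v l c : ccvg u l -> ccvg v c -> ccvg (fun k => u k * v k) (l * c).
Proof.
move=> [u1 u2] [v1 v2]; split.
- by rewrite cReM; under eq_fun do rewrite cReM; apply: cvgB; exact: cvgM.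
- by rewrite cImM; under eq_fun do rewrite cImM; apply: cvgD; exact: cvgM.
Qed.

Lemma ccvg_unique u l c : ccvg u l -> ccvg u c -> l = c.
Proof.
by move=> [u1 u2] [v1 v2]; apply: ReImP;
  [exact: cvg_unique u1 v1|exact: cvg_unique u2 v2].
Qed.

Lemma ccvg0_bound u (e : nat -> R) : e @ \oo --> 0 ->
  (forall k, `|u k| <= (e k)%:C%C) -> ccvg u 0.
Proof.
move=> e0 ue; split; apply: norm_cvg0; apply: squeeze_cvgr (cvg_cst 0) e0.
- by apply: nearW => k; rewrite normr_ge0 -lecR (le_trans (normr_Re _)).
- by apply: nearW => k; rewrite normr_ge0 -lecR (le_trans (normr_Im _)).
Qed.

Local Notation sym k := `[- (k%:R : R), k%:R].

Lemma Rintegral_sym_cvg (phi : R -> R) : mu.-integrable [set: R] (EFin \o phi) ->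
  (fun k : nat => Rintegral mu (sym k) phi) @ \oo --> Rintegral mu [set: R] phi.
Proof.
move=> iphi.
have mphi : measurable_fun [set: R] phi.
  by apply/measurable_EFinP; exact: (measurable_int mu).
have [|||||_ _] := @dominated_convergence _ _ R mu [set: R] measurableT
    (fun k => EFin \o (phi \_ (sym k))) (EFin \o phi) (abse \o (EFin \o phi)).
- move=> k; apply/measurable_EFinP.
  by apply/measurable_restrict => //; exact: measurable_funS mphi.
- exact/measurable_EFinP.
- apply: aeW => x _; apply/fine_cvgP; split; first exact: nearW.
  apply: cvg_near_cst; near=> k.
  rewrite /= patchE mem_set//= in_itv /= -ler_norml.
  near: k; exact: nbhs_infty_ger.
- exact: integrable_abse.
- apply: aeW => x k _ /=; rewrite lee_fin patchE; case: ifP => // _.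
  by rewrite normr0.
- rewrite -[X in _ --> X]fineK; last exact: integrable_fin_num.
  move=> /fine_cvgP[_]; apply: cvg_trans; apply: near_eq_cvg.
  apply: nearW => k; rewrite /Rintegral /= [in RHS]integral_mkcond /=.
  by rewrite restrict_EFin.
Unshelve. all: by end_near. Qed.

(** The principal value at infinity.  It exists for [1 / (x - w)], which is not
    integrable on the line. *)
Definition pv f l : Prop := ccvg (fun k => cint (sym k) f) l.

Lemma cint_pv f : cintegrable [set: R] f -> pv f (cint [set: R] f).
Proof. by move=> [f1 f2]; split; exact: Rintegral_sym_cvg. Qed.

Lemma pvD f g l c : ccont f -> ccont g -> pv f l -> pv g c ->
  pv (fun x => f x + g x) (l + c).
Proof.
move=> cf cg pf pg; rewrite /pv; have := ccvgD pf pg.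
congr ccvg; apply/funext => k; rewrite cintD//; exact: ccont_integrable.
Qed.

Lemma pvZ c f l : ccont f -> pv f l -> pv (fun x => c * f x) (c * l).
Proof.
move=> cf pf; rewrite /pv; have := ccvgM (ccvg_cst c) pf.
congr ccvg; apply/funext => k; rewrite cintZ//; exact: ccont_integrable.
Qed.

(** Componentwise for the same reason as [ccont]. *)
Definition cderiv f g : Prop := forall x : R,
  is_derive x 1 (fun x => Re (f x)) (Re (g x)) /\
  is_derive x 1 (fun x => Im (f x)) (Im (g x)).

Lemma cderivM f g f' g' : cderiv f f' -> cderiv g g' ->
  cderiv (fun x => f x * g x) (fun x => f' x * g x + f x * g' x).
Proof.
move=> df dg x; have [f1 f2] := df x; have [g1 g2] := dg x; split.
- under eq_fun do rewrite cReM.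
  apply: is_derive_eq; rewrite /GRing.scale /= !(cReD, cReM); ring.
- under eq_fun do rewrite cImM.
  apply: is_derive_eq; rewrite /GRing.scale /= !(cImD, cImM); ring.
Qed.

Lemma Rintegral_FTC (phi Phi : R -> R) (a b : R) : a <= b -> continuous phi ->
  (forall x : R, is_derive x 1 Phi (phi x)) ->
  Rintegral mu `[a, b] phi = Phi b - Phi a.
Proof.
rewrite le_eqVlt => /predU1P[<-|ab] cphi dPhi.
  by rewrite set_itv1 Rintegral_set1 subrr.
have cPhi : continuous Phi.
  by move=> x; apply: differentiable_continuous; apply/derivable1_diffP;
    have [] := dPhi x.
rewrite /Rintegral (@continuous_FTC2 R phi Phi)//.
- exact: continuous_subspaceT.
- split; [by move=> x _; have [] := dPhi x| |].
    by apply: cvg_at_right_filter; exact: cPhi.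
  by apply: cvg_at_left_filter; exact: cPhi.
- by move=> x _; rewrite derive1E; apply: derive_val.
Qed.

Lemma pv_primitive F f : ccont f -> cderiv F f ->
  ccvg (fun k => F k%:R) 0 -> ccvg (fun k => F (- k%:R)) 0 -> pv f 0.
Proof.
move=> [c1 c2] dF F1 F2.
have := ccvgD F1 (ccvgM (ccvg_cst (-1)) F2); rewrite mulr0 addr0.
rewrite /pv; congr ccvg; apply/funext => k; rewrite /cint mulN1r.
have k0 : - (k%:R : R) <= k%:R by rewrite (@le_trans _ _ 0)// oppr_le0.
rewrite (Rintegral_FTC k0 c1 (fun x => (dF x).1)).
rewrite (Rintegral_FTC k0 c2 (fun x => (dF x).2)).
by case: (F _); case: (F _).
Qed.

End ComplexLimits.

(** * Principal values of negative powers *)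

Section CauchyPrincipalValue.
Variable R : realType.
Implicit Types (d q N : {poly R[i]}) (w : R[i]) (x : R).
Local Notation mu := (@lebesgue_measure R).
Local Notation Re := (@complex.Re R).
Local Notation Im := (@complex.Im R).
Local Notation simple_pole w := (fun x : R => (x%:C%C - w)^-1).

Lemma real_sub_neq0 w x : Im w != 0 -> x%:C%C - w != 0.
Proof.
by apply: contraNneq => /eqP; rewrite subr_eq0 => /eqP <-.
Qed.

Lemma ccont_simple_pole w : Im w != 0 -> ccont (simple_pole w).
Proof.
move=> w0; apply: ccontV => [x|]; first exact: real_sub_neq0.
by apply: ccontD; [exact: ccont_id|exact: ccont_cst].
Qed.

Lemma ccontX (f : R -> R[i]) k : ccont f -> ccont (fun x => f x ^+ k).
Proof.
move=> cf; elim: k => [|k IH].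
  by under eq_fun do rewrite expr0; exact: ccont_cst.
by under eq_fun do rewrite exprS; exact: ccontM.
Qed.

Lemma simple_pole_Re w x :
  Re (x%:C%C - w)^-1 = (x - Re w) / ((x - Re w) ^+ 2 + Im w ^+ 2).
Proof. by case: w => u v; rewrite cReV /= sub0r sqrrN. Qed.

Lemma simple_pole_Im w x :
  Im (x%:C%C - w)^-1 = Im w / ((x - Re w) ^+ 2 + Im w ^+ 2).
Proof. by case: w => u v; rewrite cImV /= sub0r sqrrN opprK. Qed.

Lemma simple_pole_den w x : Im w != 0 -> 0 < (x - Re w) ^+ 2 + Im w ^+ 2.
Proof.
by move=> w0; rewrite ltr_wpDl ?sqr_ge0// exprn_even_gt0.
Qed.

Lemma cderiv_simple_pole w : Im w != 0 ->
  cderiv (simple_pole w) (fun x => - (x%:C%C - w)^-1 ^+ 2).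
Proof.
move=> w0 x; have D0 := simple_pole_den x w0.
have D1 : (x - Re w) ^+ 2 + Im w ^+ 2 != 0 by rewrite gt_eqF.
have -> : - (x%:C%C - w)^-1 ^+ 2 = -1 * ((x%:C%C - w)^-1 * (x%:C%C - w)^-1).
  by rewrite mulN1r expr2.
rewrite !(cReM, cImM) !(simple_pole_Re, simple_pole_Im) /=.
split.
- under eq_fun do rewrite simple_pole_Re.
  apply: is_derive_eq.
  by rewrite /GRing.scale /=; field.
- under eq_fun do rewrite simple_pole_Im.
  apply: is_derive_eq.
  by rewrite /GRing.scale /=; field.
Qed.

Lemma cderiv_simple_poleX w k : Im w != 0 ->
  cderiv (fun x : R => - (k.+1)%:R^-1 * (x%:C%C - w)^-1 ^+ k.+1)
         (fun x => (x%:C%C - w)^-1 ^+ k.+2).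
Proof.
move=> w0; have D := cderiv_simple_pole w0.
have H j : cderiv (fun x => (x%:C%C - w)^-1 ^+ j.+1)
    (fun x => - (j.+1)%:R * (x%:C%C - w)^-1 ^+ j.+2).
  elim: j => [|j IH].
    by have := D; congr cderiv; apply/funext => x; rewrite mulN1r.
  have := cderivM IH D; congr cderiv; apply/funext => x; first by rewrite -exprSr.
  rewrite mulrN -exprD addn2 -mulrA -exprSr -[j.+2%:R]natr1; ring.
have dcst (c : R[i]) : cderiv (fun=> c) (fun=> 0).
  by move=> x; split; exact: is_derive_cst.
have := cderivM (dcst (- (k.+1)%:R^-1)) (H k).
congr cderiv; apply/funext => x.
by rewrite mul0r add0r mulrA mulrNN mulVf ?mul1r// pnatr_eq0.
Qed.

Lemma simple_pole_decay w (e : R) : Im w != 0 -> `|e| = 1 ->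
  ccvg (fun k => ((e * k%:R)%:C%C - w)^-1) 0.
Proof.
move=> w0 e1; have [c c0 Hc] := XsubC_growth w0.
(* The factor 2 comes from [(k + 1) / 2 <= sqrt (1 + k^2)]. *)
apply: (@ccvg0_bound R _ (fun k => (2 / c) * harmonic k)).
  by rewrite -[X in _ --> X](mulr0 (2 / c)); apply: cvgMr; exact: cvg_harmonic.
move=> k; rewrite normfV invf_ple ?posrE; last 2 first.
- by rewrite normr_gt0 real_sub_neq0.
- by rewrite -[ltLHS]/(0%:C%C) ltcR mulr_gt0 ?divr_gt0// /harmonic invr_gt0.
apply: le_trans (Hc _); rewrite -fmorphV lecR /harmonic !invfM !invrK mulrAC.
rewrite [leRHS]mulrC ler_pM2r//.
rewrite -[leLHS]ger0_norm; last by rewrite mulr_ge0.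
have e2 : e ^+ 2 = 1 by rewrite -(real_normK (num_real e)) e1 expr1n.
rewrite -sqrtr_sqr ler_wsqrtr// /oneDsqr [(e * _) ^+ 2]exprMn e2 mul1r.
rewrite -[k.+1%:R]natr1; have := sqr_ge0 (k%:R - 1 : R); move: k%:R (ler0n R k) => t t0.
have -> : (2^-1 * (t + 1)) ^+ 2 = (t ^+ 2 + 2 * t + 1) / 4 by field.
nra.
Qed.

Lemma ccvg0X (u : nat -> R[i]) k : ccvg u 0 -> ccvg (fun j => u j ^+ k.+1) 0.
Proof.
move=> u0; elim: k => [//|k IH].
rewrite -[0 in X in ccvg _ X](mul0r 0); under eq_fun do rewrite exprS.
exact: ccvgM.
Qed.

(** The higher powers have a rational primitive, which vanishes at infinity. *)
Lemma pv_multiple_pole w k : Im w != 0 ->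
  pv (fun x => (x%:C%C - w)^-1 ^+ k.+2) 0.
Proof.
move=> w0; apply: pv_primitive (cderiv_simple_poleX k w0) _ _.
- by apply: ccontX; exact: ccont_simple_pole.
- rewrite -[0 in X in ccvg _ X](mulr0 (- k.+1%:R^-1)).
  apply: ccvgM; first exact: ccvg_cst.
  apply: ccvg0X; have := @simple_pole_decay w 1 w0 (normr1 _).
  by under eq_fun do rewrite mul1r.
- rewrite -[0 in X in ccvg _ X](mulr0 (- k.+1%:R^-1)).
  apply: ccvgM; first exact: ccvg_cst.
  apply: ccvg0X; have := @simple_pole_decay w (-1) w0.
  by rewrite normrN1 => /(_ erefl); under eq_fun do rewrite mulN1r.
Qed.

(** The integral of [1 / (x - w)] over [-k, k] has the primitive
    [ln |x - w|] for its real part, whose values at the ends cancel in the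
    limit, and an arctangent for its imaginary part, which contributes half
    a turn. *)
Lemma pv_simple_pole w : Im w < 0 -> pv (simple_pole w) (- (pi%:C%C * 'i)).
Proof.
move=> w0; have wN0 : Im w != 0 by rewrite lt_eqF.
have vN0 : - Im w != 0 by rewrite oppr_eq0.
have k0 k : - (k%:R : R) <= k%:R by rewrite (@le_trans _ _ 0)// oppr_le0.
have [c1 c2] := ccont_simple_pole wN0.
split.
- pose Q x := (x - Re w) ^+ 2 + Im w ^+ 2.
  have Qgt0 x : 0 < Q x by exact: simple_pole_den.
  have QN0 x : Q x != 0 by rewrite gt_eqF.
  pose F x := 2^-1 * ln (Q x).
  have dF (x : R) : is_derive x 1 F (Re (x%:C%C - w)^-1).
    rewrite simple_pole_Re -/(Q x).
    have dQ : is_derive x 1 Q (2 * (x - Re w)).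
      by apply: is_derive_eq; rewrite /GRing.scale /=; ring.
    have dln : is_derive (Q x) 1 (@ln R) (Q x)^-1 by exact: is_derive1_ln.
    have := is_deriveZ (2^-1 : R) (is_derive1_comp dln dQ).
    have -> : 2^-1 *: ((Q x)^-1 * (2 * (x - Re w))) = (x - Re w) / Q x.
      by rewrite /GRing.scale /=; field.
    by apply.
  rewrite (_ : (fun k => _) = (fun k => F k%:R - F (- k%:R))); last first.
    by apply/funext => k; rewrite /cint /= (Rintegral_FTC (k0 k) c1 dF).
  rewrite (_ : Re _ = 0); last by rewrite /= mul0r mulr0 subr0 oppr0.
  have [p1 p2] := @simple_pole_decay w (-1) wN0 (normrN1 _).
  pose r k := 1 + 4 * Re w * Re ((-1 * (k%:R : R))%:C%C - w)^-1 +
    4 * Re w ^+ 2 / Im w * Im ((-1 * (k%:R : R))%:C%C - w)^-1.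
  have rE k : F k%:R - F (- k%:R) = 2^-1 * ln (r k).
    rewrite /F -mulrBr -ln_div ?posrE//; congr (_ * ln _).
    rewrite /r mulN1r simple_pole_Re simple_pole_Im -/(Q (- k%:R)).
    rewrite -[RHS](mulfK (QN0 (- k%:R))); congr (_ / _).
    have := QN0 (- k%:R); rewrite /Q => QN; field.
    by rewrite QN wN0.
  under eq_fun do rewrite rE.
  have -> : (0 : R) = 2^-1 * ln 1 by rewrite ln1 mulr0.
  apply: cvgMr.
  apply: (@cvg_comp _ _ _ r (@ln R) _ (nbhs (1 : R))); last exact: continuous_ln.
  rewrite (_ : 1 = 1 + 4 * Re w * 0 + 4 * Re w ^+ 2 / Im w * 0); last first.
    by rewrite !mulr0 !addr0.
  apply: cvgD; [apply: cvgD; [exact: cvg_cst|exact: cvgMr]|exact: cvgMr].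
- pose F x := - atan ((x - Re w) / (- Im w)).
  have dF (x : R) : is_derive x 1 F (Im (x%:C%C - w)^-1).
    rewrite simple_pole_Im.
    have dQ : is_derive x 1 (fun x => (x - Re w) / (- Im w)) (- Im w)^-1.
      by apply: is_derive_eq; rewrite /GRing.scale /=; ring.
    have := is_deriveN (is_derive1_comp (is_derive1_atan _) dQ).
    have -> : - ((1 + ((x - Re w) / - Im w) ^+ 2)^-1 * (- Im w)^-1) =
        Im w / ((x - Re w) ^+ 2 + Im w ^+ 2).
      have := simple_pole_den x wN0; rewrite lt0r => /andP[h _].
      field; rewrite wN0 andbT; exact: h.
    by [].
  rewrite (_ : (fun k => _) = (fun k => F k%:R - F (- k%:R))); last first.
    by apply/funext => k; rewrite /cint /= (Rintegral_FTC (k0 k) c2 dF).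
  have lim (u : R) : (fun k : nat => atan ((k%:R - u) / - Im w)) @ \oo --> pi / 2.
    have v0 : 0 < (- Im w)^-1 by rewrite invr_gt0 oppr_gt0.
    have h : atan ((x - u) / - Im w) @[x --> +oo%R] --> pi / 2.
      apply: (@cvg_comp _ _ _ (fun x => (x - u) / - Im w) (@atan R) _ (+oo%R)).
        exact: gt0_cvgMly v0 (cvg_addrr (- u)).
      exact: cvgy_atan.
    exact: (cvg_comp _ _ (@cvgr_idn R) h).
  have -> : (fun k : nat => F k%:R - F (- k%:R)) = (fun k : nat =>
     - (atan ((k%:R - Re w) / - Im w) + atan ((k%:R - - Re w) / - Im w))).
    apply/funext => k; rewrite /F opprK opprD; congr (_ + _).
    by rewrite -atanN; congr (atan _); field.
  have -> : complex.Im (- ((pi : R)%:C%C * 'i)) = - (pi / 2 + pi / 2).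
    by rewrite /= mul0r addr0 mulr1 -splitr.
  by apply: cvgN; apply: cvgD; exact: lim.
Qed.

End CauchyPrincipalValue.

(** * Residues and the Poisson formula for rational functions *)

Section PoissonFormula.
Variable R : realType.
Implicit Types (d q N e : {poly R[i]}) (w : R[i]) (x : R).
Local Notation mu := (@lebesgue_measure R).
Local Notation Re := (@complex.Re R).
Local Notation Im := (@complex.Im R).

(** The property of [d] that makes [q / d] holomorphic on the closed upper
    half-plane. *)
Definition lower_roots d : Prop := forall z : R[i], 0 <= Im z -> d.[z] != 0.

Lemma lower_roots_neq0 d : lower_roots d -> d != 0.
Proof. by move=> /(_ 0 (lexx _)); apply: contraNneq => ->; rewrite horner0. Qed.

Lemma lower_roots_real d x : lower_roots d -> d.[x%:C%C] != 0.
Proof. exact. Qed.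

(** The residue theorem for [N / d] on the upper half-plane, where only the
    point at infinity contributes.  Subtracting a multiple of
    [(x - w)^-(k + 1)], with [k + 1] the multiplicity of a root [w] of [d],
    cancels one factor [x - w]; only the terms with [k = 0] have a nonzero
    principal value, and they are the ones that contribute to the coefficient
    of [N] just below the degree of [d]. *)
Lemma pv_ratio N d : lower_roots d -> (size N < size d)%N ->
  pv (fun x => N.[x%:C%C] / d.[x%:C%C])
     (N`_(size d).-2 / lead_coef d * - (pi%:C%C * 'i)).
Proof.
have [m] := ubnP (size d); elim: m N d => // m IH N d dm dlow sN.
have d0 := lower_roots_neq0 dlow.
have [sd|sd] := leqP (size d) 1.
  have -> : N = 0 by apply/eqP; rewrite -size_poly_eq0; lia.
  rewrite coef0 !mul0r; have := @cint_pv R (fun=> 0) (cintegrable0 measurableT).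
  rewrite cint0//; congr pv; apply/funext => x.
  by rewrite horner0 mul0r.
(* From here on [d = e (x - w)^(k + 1)] and [N = c e + (x - w) N']. *)
have /closed_rootP[w dw] : size d != 1%N by rewrite gtn_eqF.
have w0 : Im w < 0.
  by rewrite ltNge; apply: contraTN dw => /dlow.
have wN0 : Im w != 0 by rewrite lt_eqF.
have [k [e]] := multiplicity_XsubC d w; rewrite d0 /= => ew dE.
case: k dE => [|k] dE; first by rewrite dE expr0 mulr1 (negPf ew) in dw.
have e0 : e != 0 by apply: contraNneq ew => ->; rewrite root0.
pose c := N.[w] / e.[w].
have /factor_theorem[N' NE] : root (N - c *: e) w.
  by rewrite rootE !hornerE /c divfK ?subrr// -rootE.
pose d' := e * ('X - w%:P) ^+ k.
have dE' : d = d' * ('X - w%:P) by rewrite dE /d' exprSr mulrA.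
have d'0 : d' != 0 by apply: contraNneq d0 => d'0; rewrite dE' d'0 mul0r.
have sd' : size d = (size d').+1.
  by rewrite dE' size_Mmonic ?monicXsubC// size_XsubC addn2.
have se : size d = (size e + k.+1)%N.
  by rewrite dE size_Mmonic ?monic_exp ?monicXsubC// size_exp_XsubC addnS.
have e_gt0 : (0 < size e)%N by rewrite size_poly_gt0.
have ld : lead_coef d = lead_coef d' by rewrite dE' lead_coef_Mmonic ?monicXsubC.
have le : lead_coef d = lead_coef e.
  by rewrite dE lead_coef_Mmonic ?monic_exp ?monicXsubC.
have sN' : (size N' < size d')%N.
  have [->|N'0] := eqVneq N' 0; first by rewrite size_poly0 size_poly_gt0.
  have : (size (N - c *: e)%R <= (size d).-1)%N.
    apply: leq_trans (size_polyD _ _) _; rewrite geq_max size_polyN.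
    apply/andP; split; first by lia.
    by apply: leq_trans (size_scale_leq _ _) _; lia.
  by rewrite NE size_Mmonic ?monicXsubC// size_XsubC addn2 sd'.
have d'low : lower_roots d'.
  by move=> z /dlow; apply: contraNneq => z0; rewrite dE' hornerM z0 mul0r.
have := IH N' d' _ d'low sN'; rewrite -ltnS -sd' => /(_ dm) pv'.
have cp := ccont_simple_pole wN0.
have pole : pv (fun x => (x%:C%C - w)^-1 ^+ k.+1)
    ((k == 0%N)%:R * - (pi%:C%C * 'i)).
  case: (k) => [|j]; rewrite ?mul1r ?mul0r; first exact: pv_simple_pole.
  exact: pv_multiple_pole.
have := pvD (ccontM (ccont_cst c) (ccontX k.+1 cp))
   (ccont_ratio _ (fun x => lower_roots_real x d'low)) (pvZ c (ccontX k.+1 cp) pole) pv'.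
congr pv.
  apply/funext => x.
  have ex : e.[x%:C%C] != 0.
    by have := lower_roots_real x dlow; rewrite dE hornerM mulf_eq0 negb_or => /andP[].
  have -> : N = N' * ('X - w%:P) + c *: e by rewrite -NE subrK.
  rewrite dE /d' !hornerE exprVn exprS.
  have z0 := real_sub_neq0 x wN0; move: (x%:C%C - w) z0 => z z0.
  by field; rewrite expf_neq0 ?z0 ?ex.
rewrite -ld [in LHS]mulrA -mulrDl; congr (_ * _).
rewrite -[c * _](mulfK (_ : lead_coef d != 0)) ?lead_coef_eq0// -mulrDl.
congr (_ / _).
have -> : N = N' * ('X - w%:P) + c *: e by rewrite -NE subrK.
rewrite sd' /= coefD coefZ mulrBr coefB coefMX coefMC.
rewrite [N'`_(size d').-1]nth_default ?mul0r ?subr0; last first.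
  by move: sN'; case: (size d').
have eE : e`_(size d').-1 = (k == 0%N)%:R * lead_coef d.
  rewrite le /lead_coef; case: (k) se => [|j] se; rewrite ?mul1r ?mul0r.
    by congr (e`_ _); lia.
  by move: se; rewrite sd' addnS => -[->]; rewrite nth_default// addnS leq_addr.
rewrite eE -mulrA addrC; congr (_ + _); case: eqP => // d1.
by rewrite nth_default//; move: sN'; rewrite d1; case: (size d') d1 => // j /= ->.
Qed.

(** Here the integral converges absolutely and the contribution of the point at
    infinity vanishes. *)
Lemma cint_ratio_eq0 N d : lower_roots d -> (size N + 2 <= size d)%N ->
  cint [set: R] (fun x => N.[x%:C%C] / d.[x%:C%C]) = 0.
Proof.
move=> dlow sN.
have iN := ratio_cintegrable (fun x => lower_roots_real x dlow) sN.
apply: (ccvg_unique (cint_pv iN)).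
have := @pv_ratio N d dlow; rewrite nth_default; last first.
  by move: sN; rewrite addn2; case: (size d) => [|[|k]].
by rewrite !mul0r; apply; apply: leq_trans sN; rewrite addn2.
Qed.

Lemma pv_conj f l : ccont f -> pv f l -> pv (fun x => (f x)^*) l^*.
Proof.
move=> cf [p1 p2].
have E k : cint `[- (k%:R : R), k%:R] (fun x => (f x)^*) =
    (cint `[- (k%:R : R), k%:R] f)^*.
  by rewrite cint_conj//; exact: ccont_integrable.
rewrite /pv; under eq_fun do rewrite E; split.
  by rewrite cReJ; under eq_fun do rewrite cReJ.
by rewrite cImJ; under eq_fun do rewrite cImJ; exact: cvgN.
Qed.

Variables (alpha : R[i]) (alpha_gt0 : 0 < Im alpha).

(** The Poisson kernel of the upper half-plane at [alpha], written so that it is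
    visibly a rational function of [x]. *)
Definition poisson x : R[i] :=
  (Im alpha / pi)%:C%C / ((x%:C%C - alpha) * (x%:C%C - alpha^*)).

Let conj_alpha_lower : Im alpha^* < 0.
Proof. by rewrite cImJ oppr_lt0. Qed.

Let aN0 : Im alpha != 0. Proof. by rewrite gt_eqF. Qed.

Let caN0 : Im alpha^* != 0. Proof. by rewrite lt_eqF. Qed.

Let pi0 : (pi : R)%:C%C != 0.
Proof. by rewrite -[0]/(0%:C%C) (inj_eq (@complexI _)) gt_eqF ?pi_gt0. Qed.

Lemma poissonE x : poisson x =
  (2 * 'i * (pi : R)%:C%C)^-1 * (x%:C%C - alpha)^-1 +
  - (2 * 'i * (pi : R)%:C%C)^-1 * (x%:C%C - alpha^*)^-1.
Proof.
have i0 : 'i != 0 :> R[i] by rewrite neq0Ci.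
have aE : (Im alpha)%:C%C = ((x%:C%C - alpha^*) - (x%:C%C - alpha)) / (2 * 'i).
  have sub : alpha - alpha^* = 2 * (Im alpha)%:C%C * 'i := subcJ alpha.
  rewrite (_ : _ - _ - _ = alpha - alpha^*); last by ring.
  by rewrite sub; field; exact: i0.
rewrite /poisson rmorphM fmorphV /= aE.
have z0 := real_sub_neq0 x aN0; have zc0 := real_sub_neq0 x caN0.
move: z0 zc0 pi0; move: (x%:C%C - alpha) (x%:C%C - alpha^*) (pi%:C%C) => y z p y0 z0 p0.
by field; rewrite y0 z0 p0 i0.
Qed.

Lemma poisson_real x : (poisson x)^* = poisson x.
Proof.
have E z : (x%:C%C - z)^* = x%:C%C - z^*.
  by rewrite rmorphB /= conj_Creal// complex_real.
rewrite /poisson rmorphM fmorphV /= conj_Creal ?complex_real//.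
by rewrite [((_ - _) * _)^*]rmorphM /= !E conjCK [X in _ / X]mulrC.
Qed.

Lemma poisson_gt0 x : 0 < poisson x.
Proof.
have xa : x%:C%C - alpha != 0 by rewrite real_sub_neq0// gt_eqF.
rewrite /poisson; have -> : x%:C%C - alpha^* = (x%:C%C - alpha)^*.
  by rewrite rmorphB /= [in RHS]conj_Creal// complex_real.
rewrite -normCK divr_gt0 ?exprn_gt0 ?normr_gt0//.
by rewrite -[ltLHS]/(0%:C%C) ltcR divr_gt0 ?pi_gt0.
Qed.

Lemma pv_poisson : pv poisson 1.
Proof.
have cp := ccont_simple_pole caN0.
have p1 := pv_simple_pole conj_alpha_lower.
have p2 := pv_conj cp p1.
have cc : ccont (fun x => (x%:C%C - alpha)^-1) := ccont_simple_pole aN0.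
have E : (fun x : R => ((x%:C%C - alpha^*)^-1)^*) = (fun x => (x%:C%C - alpha)^-1).
  by apply/funext => x; rewrite fmorphV rmorphB /= conjCK conj_Creal// complex_real.
rewrite E in p2.
have := pvD (ccontM (ccont_cst _) cc) (ccontM (ccont_cst _) cp)
  (pvZ (2 * 'i * (pi : R)%:C%C)^-1 cc p2) (pvZ (- (2 * 'i * (pi : R)%:C%C)^-1) cp p1).
congr pv; first by apply/funext => x; rewrite poissonE.
have i0 : 'i != 0 :> R[i] by rewrite neq0Ci.
rewrite rmorphN rmorphM /= conjCi conj_Creal ?complex_real//.
move: pi0 i0; move: (pi%:C%C) ('i) => p j p0 j0.
by field; rewrite j0 p0.
Qed.

(** Subtracting the value [c] at [alpha] from [q / d] cancels the pole of the
    kernel at [alpha], and what remains has no pole above the axis. *)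
Theorem poisson_formula q d : lower_roots d -> (size q <= size d)%N ->
  cintegrable [set: R] (fun x => poisson x * (q.[x%:C%C] / d.[x%:C%C])) /\
  cint [set: R] (fun x => poisson x * (q.[x%:C%C] / d.[x%:C%C])) =
    q.[alpha] / d.[alpha].
Proof.
move=> dlow sq /=; set c := q.[alpha] / d.[alpha].
have d0 := lower_roots_neq0 dlow.
have da0 : d.[alpha] != 0 by apply: dlow; exact: ltW.
have /factor_theorem[S SE] : root (q - c *: d) alpha.
  by rewrite rootE !hornerE /c divfK ?subrr.
have sS : (size S < size d)%N.
  have [->|S0] := eqVneq S 0; first by rewrite size_poly0 size_poly_gt0.
  have : (size (q - c *: d)%R <= size d)%N.
    apply: leq_trans (size_polyD _ _) _; rewrite geq_max size_polyN sq.
    exact: size_scale_leq.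
  by rewrite SE size_Mmonic ?monicXsubC// size_XsubC addn2.
have d1low : lower_roots (('X - (alpha^*)%:P) * d).
  move=> z z0; rewrite hornerM hornerXsubC mulf_neq0 ?dlow// subr_eq0.
  by apply: contraTneq z0 => ->; rewrite -ltNge.
have sd1 : size (('X - (alpha^*)%:P) * d) = (size d).+1.
  by rewrite size_monicM ?monicXsubC// size_XsubC.
have sSd : (size ((Im alpha / pi)%:C%C *: S)%R + 2 <=
    size (('X - (alpha^*)%:P) * d)%R)%N.
  rewrite sd1 addn2 !ltnS; apply: leq_ltn_trans sS.
  exact: size_scale_leq.
have i1 := ratio_cintegrable (fun x => lower_roots_real x d1low) sSd.
have I1 := cint_ratio_eq0 d1low sSd.
have iP : cintegrable [set: R] poisson.
  have E : poisson = fun x : R => (((Im alpha / pi)%:C%C)%:P).[x%:C%C] /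
      (('X - alpha%:P) * ('X - (alpha^*)%:P)).[x%:C%C].
    by apply/funext => x; rewrite !hornerE.
  rewrite E; apply: ratio_cintegrable => [x|].
    by rewrite !hornerE mulf_neq0// real_sub_neq0.
  rewrite size_monicM ?monicXsubC ?polyXsubC_eq0// !size_XsubC.
  by rewrite size_polyC; case: (_ != 0).
have IP : cint [set: R] poisson = 1 := ccvg_unique (cint_pv iP) pv_poisson.
have E : (fun x => poisson x * (q.[x%:C%C] / d.[x%:C%C])) = (fun x : R =>
    c * poisson x + ((Im alpha / pi)%:C%C *: S).[x%:C%C] /
      (('X - (alpha^*)%:P) * d).[x%:C%C]).
  apply/funext => x; have dx := lower_roots_real x dlow.
  have -> : q = S * ('X - alpha%:P) + c *: d by rewrite -SE subrK.
  have z0 := real_sub_neq0 x aN0; have zc0 := real_sub_neq0 x caN0.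
  rewrite /poisson hornerD !hornerM !hornerXsubC !hornerZ.
  move: (x%:C%C - alpha) (x%:C%C - alpha^*) z0 zc0.
  move: ((Im alpha / pi)%:C%C) => A y z y0 z0.
  by field; rewrite dx y0 z0.
have iZ := cintegrableZ c measurableT iP; rewrite E; split.
  exact: cintegrableD.
by rewrite cintD// cintZ// IP I1 mulr1 addr0.
Qed.

End PoissonFormula.

(** * Moment functionals and the Hankel form *)

Section MomentFunctional.
Variables (R : realType) (p : nat).
Local Notation C := R[i].
Local Notation Re := (@complex.Re R).
Local Notation Im := (@complex.Im R).
Implicit Types (h : nat -> 'M[C]_p) (r s : {poly C}) (f g : 'cV[{poly C}]_p).

Definition momf h r : 'M[C]_p := \sum_(k < size r) r`_k *: h k.

Lemma momf_widen h r m : (size r <= m)%N ->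
  momf h r = \sum_(k < m) r`_k *: h k.
Proof.
move=> rm; rewrite /momf (big_ord_widen m (fun k => r`_k *: h k))// [RHS]big_mkcond /=.
rewrite big_mkcond; apply: eq_bigr => k _; case: ltnP => // kr.
by rewrite nth_default ?scale0r.
Qed.

Lemma momfD h r s : momf h (r + s) = momf h r + momf h s.
Proof.
rewrite (@momf_widen _ _ (maxn (size r) (size s)) (size_polyD r s)).
rewrite (@momf_widen _ r (maxn (size r) (size s))) ?leq_maxl//.
rewrite (@momf_widen _ s (maxn (size r) (size s))) ?leq_maxr//.
by rewrite -big_split; apply: eq_bigr => k _; rewrite coefD scalerDl.
Qed.

Lemma momfZ h c r : momf h (c *: r) = c *: momf h r.
Proof.
rewrite (@momf_widen _ _ (size r) (size_scale_leq c r)) scaler_sumr.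
by apply: eq_bigr => k _; rewrite coefZ scalerA.
Qed.

Lemma momf0 h : momf h 0 = 0.
Proof. by rewrite /momf size_poly0 big_ord0. Qed.

Lemma momf_sum h I (t : seq I) (P : pred I) (F : I -> {poly C}) :
  momf h (\sum_(i <- t | P i) F i) = \sum_(i <- t | P i) momf h (F i).
Proof. by apply: (big_morph _ (@momfD h) (momf0 h)). Qed.

Lemma momfXn h k : momf h 'X^k = h k.
Proof.
rewrite /momf size_polyXn (bigD1 ord_max)//= coefXn eqxx scale1r.
rewrite big1 ?addr0// => i; rewrite -val_eqE /= coefXn => /negPf ->.
by rewrite scale0r.
Qed.

Lemma poly_sumXn r m : (size r <= m)%N -> r = \sum_(i < m) r`_i *: 'X^i.
Proof. by move=> rm; rewrite -{1}(take_poly_id rm) /take_poly poly_def. Qed.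

Lemma momfM h r s m l : (size r <= m)%N -> (size s <= l)%N ->
  momf h (r * s) = \sum_(i < m) \sum_(j < l) (r`_i * s`_j) *: h (i + j)%N.
Proof.
move=> rm sl; rewrite {1}(poly_sumXn rm) {1}(poly_sumXn sl) mulr_suml momf_sum.
apply: eq_bigr => i _; rewrite mulr_sumr momf_sum; apply: eq_bigr => j _.
by rewrite -scalerAl -scalerAr scalerA -exprD momfZ momfXn.
Qed.

Definition conjp r : {poly C} := map_poly Num.conj r.

Lemma coef_conjp r k : (conjp r)`_k = (r`_k)^*.
Proof. exact: coef_map. Qed.

Lemma size_conjp r : size (conjp r) = size r.
Proof. exact: size_map_poly. Qed.

Lemma conjpK r : conjp (conjp r) = r.
Proof. by apply/polyP => k; rewrite !coef_conjp conjCK. Qed.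

Lemma conjpM r s : conjp (r * s) = conjp r * conjp s.
Proof. exact: rmorphM. Qed.

Lemma conjpD r s : conjp (r + s) = conjp r + conjp s.
Proof. exact: rmorphD. Qed.

Lemma conjp_XsubC (c : C) : conjp ('X - c%:P) = 'X - (c^*)%:P.
Proof. by rewrite /conjp rmorphB /= map_polyX map_polyC. Qed.

Lemma horner_conjp r (z : C) : (conjp r).[z] = (r.[z^*])^*.
Proof. by rewrite -[in LHS](conjCK z) horner_map. Qed.

(** The sesquilinear form on vector polynomials defined by the moments [h].
    Multiplication by a polynomial acts on the product inside the moment
    functional, so it can be moved from one argument to the other up to
    conjugation: this is the Hankel structure. *)
Definition hform h f g : C :=
  \sum_a \sum_b momf h (conjp (g a 0) * f b 0) a b.

Lemma hformDl h f1 f2 g : hform h (f1 + f2) g = hform h f1 g + hform h f2 g.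
Proof.
rewrite -big_split; apply: eq_bigr => a _; rewrite -big_split.
by apply: eq_bigr => b _ /=; rewrite mxE mulrDr momfD mxE.
Qed.

Lemma hformDr h f g1 g2 : hform h f (g1 + g2) = hform h f g1 + hform h f g2.
Proof.
rewrite -big_split; apply: eq_bigr => a _; rewrite -big_split.
by apply: eq_bigr => b _ /=; rewrite mxE conjpD mulrDl momfD mxE.
Qed.

Lemma hformCl h (c : C) f g : hform h (c%:P *: f) g = c * hform h f g.
Proof.
rewrite mulr_sumr; apply: eq_bigr => a _; rewrite mulr_sumr.
by apply: eq_bigr => b _; rewrite mxE mulrCA mul_polyC momfZ mxE.
Qed.

Lemma hform_adj h r f g : hform h (r *: f) g = hform h f (conjp r *: g).
Proof.
apply: eq_bigr => a _; apply: eq_bigr => b _.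
by rewrite !mxE conjpM conjpK mulrCA mulrA.
Qed.

Lemma hformCr h (c : C) f g : hform h f (c%:P *: g) = c^* * hform h f g.
Proof. by rewrite -[c in LHS]conjCK -map_polyC -hform_adj hformCl. Qed.

Variables (h : nat -> 'M[C]_p) (n : nat).

Definition vsize_le m f : Prop := forall a, (size (f a 0)%R <= m)%N.

Hypothesis h_herm : forall k, (k <= 2 * n)%N -> (h k)^t* = h k.

Lemma hform_conj f g : vsize_le n.+1 f -> vsize_le n.+1 g ->
  (hform h f g)^* = hform h g f.
Proof.
move=> fn gn; rewrite /hform rmorph_sum /=.
under eq_bigr do rewrite rmorph_sum /=.
rewrite exchange_big /=; apply: eq_bigr => a _; apply: eq_bigr => b _ /=.
rewrite (@momfM _ _ _ n.+1 n.+1) ?size_conjp//.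
rewrite (@momfM _ _ _ n.+1 n.+1) ?size_conjp//.
rewrite [in RHS]exchange_big !summxE rmorph_sum; apply: eq_bigr => i _ /=.
rewrite !summxE rmorph_sum; apply: eq_bigr => j _ /=.
rewrite !mxE !rmorphM /= !coef_conjp conjCK; congr (_ * _).
  by rewrite mulrC.
by rewrite -[in RHS]h_herm ?mxE 1?addnC//; have := ltn_ord i; have := ltn_ord j; lia.
Qed.

Hypothesis h_pos : forall f, vsize_le n.+1 f -> f != 0 -> 0 < hform h f f.

Lemma scale_XsubC_neq0 (c : C) g : g != 0 -> ('X - c%:P) *: g != 0.
Proof.
by move=> g0; rewrite scalemx_eq0 polyXsubC_eq0.
Qed.

Lemma vsize_XsubC (c : C) g : vsize_le n g -> vsize_le n.+1 (('X - c%:P) *: g).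
Proof.
move=> gn a; rewrite mxE; have [->|g0] := eqVneq (g a 0) 0.
  by rewrite mulr0 size_poly0.
by rewrite size_monicM ?monicXsubC// size_XsubC; exact: gn.
Qed.

(** Multiplication by the variable is symmetric for the form, and its
    compression to the line of [g] is a real number [m].  With [z - lambda]
    replaced by [(z - m) - (lambda - m)] and likewise for [alpha], the cross
    terms vanish and what remains could be zero only if
    [(lambda - m) (alpha - m)^*] were a negative real number, which is
    impossible for two points above the real axis. *)
Lemma hform_XsubC_neq0 (lambda alpha : C) g : vsize_le n g -> g != 0 ->
  0 <= Im lambda -> 0 < Im alpha ->
  hform h (('X - lambda%:P) *: g) (('X - alpha%:P) *: g) != 0.
Proof.
move=> gn g0 l0 a0.
have gn1 : vsize_le n.+1 g by move=> a; rewrite (leq_trans (gn a)).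
have Xn : vsize_le n.+1 ('X *: g).
  by have := vsize_XsubC 0 gn; rewrite subr0.
have Z0 := h_pos gn1 g0; set Z := hform h g g in Z0.
pose Y := hform h ('X *: g) g.
have YR : Y^* = Y by rewrite /Y hform_conj// hform_adj /conjp map_polyX.
pose m := Y / Z.
have mR : m^* = m by rewrite /m rmorphM fmorphV /= YR (CrealP (gtr0_real Z0)).
have P0 := h_pos (vsize_XsubC m gn) (scale_XsubC_neq0 m g0).
set P := hform h _ _ in P0.
have cross1 : hform h (('X - m%:P) *: g) g = 0.
  rewrite scalerBl hformDl -/Y -scaleNr -polyCN hformCl -/Z /m.
  by rewrite mulNr divfK ?subrr// gt_eqF.
have cross2 : hform h g (('X - m%:P) *: g) = 0.
  by rewrite -[m in LHS]mR -conjp_XsubC -hform_adj cross1.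
(* The decomposition [z - c = (z - m) - (c - m)]. *)
have E (c : C) : ('X - c%:P) *: g = ('X - m%:P) *: g + (- (c - m))%:P *: g.
  by rewrite -scalerDl opprB polyCB addrA subrK.
rewrite (E lambda) (E alpha) hformDl !hformDr !hformCl !hformCr cross1 cross2.
have -> : (- (alpha - m))^* = - (alpha^* - m) by rewrite rmorphN rmorphB /= mR.
rewrite -/P -/Z !mulr0 addr0 add0r !mulNr mulrN opprK.
apply/eqP => PE.
move: mR P0 Z0 PE l0 a0; move: (m) (P) (Z) => m' P' Z'.
clear; move: m' P' Z' => m P Z.
case: m lambda alpha P Z => [m1 m2] [x y] [c a] [P1 P2] [Z1 Z2].
rewrite !ltcE /= => -[m20] /andP[/eqP -> P0] /andP[/eqP -> Z0].
have -> : m2 = 0 by lra.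
case=> E1 E2 y0 a0.
have K1 : (x - m1) * (c - m1) + y * a < 0.
  rewrite -(pmulr_llt0 _ Z0); lra.
(* [K1] and [K2] say that [(lambda - m) (alpha - m)^*] is a negative real
   number; eliminating [x - m1] between them gives the contradiction. *)
have K2 : a * (x - m1) = y * (c - m1).
  by apply: (mulIf (lt0r_neq0 Z0)); lra.
have : 0 <= a * ((x - m1) * (c - m1) + y * a).
  rewrite mulrDr mulrA K2.
  rewrite (_ : _ + _ = y * ((c - m1) ^+ 2 + a ^+ 2)); last by ring.
  by rewrite mulr_ge0// addr_ge0 ?sqr_ge0.
by rewrite pmulr_rge0// leNgt K1.
Qed.

(** The degenerate case [lambda = oo] of the previous lemma. *)
Lemma hform_XsubCr_neq0 (alpha : C) g : vsize_le n g -> g != 0 ->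
  0 < Im alpha -> hform h g (('X - alpha%:P) *: g) != 0.
Proof.
move=> gn g0 a0.
have gn1 : vsize_le n.+1 g by move=> a; rewrite (leq_trans (gn a)).
have Xn : vsize_le n.+1 ('X *: g).
  by have := vsize_XsubC 0 gn; rewrite subr0.
have Z0 := h_pos gn1 g0; set Z := hform h g g in Z0.
pose Y := hform h g ('X *: g).
have YR : Y^* = Y by rewrite /Y hform_conj// hform_adj /conjp map_polyX.
have -> : hform h g (('X - alpha%:P) *: g) = Y - alpha^* * Z.
  by rewrite scalerBl -scaleNr -polyCN hformDr hformCr rmorphN mulNr.
apply/eqP => /eqP; rewrite subr_eq0 => /eqP YE.
move: YR Z0 YE; move: (Y) (Z) => Y' Z' => YR Z0 YE; rewrite YE in YR.
move: YR Z0 a0; clear; case: alpha Z' => [c a] [Z1 Z2].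
rewrite ltcE /= => -[E] /andP[/eqP Z20 Z0] a0; rewrite Z20 in E.
have : a * Z1 = 0 by lra.
by move/eqP; rewrite mulf_eq0 !gt_eqF.
Qed.

End MomentFunctional.

(** * Adjoint matrices *)

Lemma adjmxM (C : numClosedFieldType) m k l (A : 'M[C]_(m, k)) (B : 'M[C]_(k, l)) :
  (A *m B)^t* = B^t* *m A^t*.
Proof. by rewrite trmx_mul map_mxM. Qed.

Lemma adjmxK (C : numClosedFieldType) m k (A : 'M[C]_(m, k)) : A^t*^t* = A.
Proof. exact: trmxCK. Qed.

Lemma adjmx0 (C : numClosedFieldType) m k : (0 : 'M[C]_(m, k))^t* = 0.
Proof. by rewrite trmx0 map_mx0. Qed.

Lemma adjmx_inv (C : numClosedFieldType) m (A : 'M[C]_m) :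
  (invmx A)^t* = invmx (A^t*).
Proof. by rewrite trmx_inv map_invmx. Qed.

Lemma adjmx_sum (C : numClosedFieldType) m k I (s : seq I) (F : I -> 'M[C]_(m, k)) :
  (\sum_(i <- s) F i)^t* = \sum_(i <- s) (F i)^t*.
Proof.
apply/matrixP => a b; rewrite !mxE !summxE rmorph_sum; apply: eq_bigr => i _.
by rewrite !mxE.
Qed.

Lemma adjmxZ (C : numClosedFieldType) m k (c : C) (M : 'M[C]_(m, k)) :
  (c *: M)^t* = c^* *: M^t*.
Proof. by apply/matrixP => a b; rewrite !mxE rmorphM. Qed.

Lemma adjmxV (C : numClosedFieldType) m (M : 'M[C]_m) : M \in unitmx ->
  M^t* *m (invmx M)^t* = 1%:M.
Proof.
by move=> Mu; rewrite -adjmxM mulVmx// trmx1 map_mx1.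
Qed.

Lemma invmx_sandwich (C : numClosedFieldType) m (M L : 'M[C]_m) (c r t : C) :
  M \in unitmx -> L \in unitmx -> r != 0 -> c * t = r ->
  invmx (c *: (M *m invmx (r *: L) *m M^t*)) =
    t *: ((invmx M)^t* *m L *m invmx M).
Proof.
move=> Mu Lu r0 ctr.
have inv_r (X Y : 'M[C]_m) : X *m Y = 1%:M -> invmx X = Y.
  by move=> XY; have [Xu _] := mulmx1_unit XY; rewrite -[LHS]mulmx1 -XY mulKmx.
apply: inv_r; rewrite -scalemxAl -scalemxAr scalerA ctr.
rewrite !mulmxA -(mulmxA _ (M^t*)) adjmxV// mulmx1 invmxZ; last first.
  by rewrite unitmxZ ?unitfE.
rewrite -!scalemxAr -!scalemxAl scalerA divff// scale1r.
by rewrite mulmxKV// mulmxV.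
Qed.

Lemma adjmx_sandwich (C : numClosedFieldType) m (V L : 'M[C]_m) :
  L^t* = L -> (V^t* *m L *m V)^t* = V^t* *m L *m V.
Proof. by move=> LL; rewrite !adjmxM adjmxK LL mulmxA. Qed.

Lemma adjmx_mul_self (C : numClosedFieldType) m (M S V : 'M[C]_m) (z : C) :
  S = S^t* -> S *m S = V ->
  (z *: M *m S) *m (z *: M *m S)^t* = (z * z^*) *: (M *m V *m M^t*).
Proof.
move=> SS <-; rewrite adjmxM -SS adjmxZ.
by rewrite -!scalemxAl -!scalemxAr scalerA !mulmxA.
Qed.

Lemma adjmx_congr (C : numClosedFieldType) m k (F : 'M[C]_(m, k)) (V : 'M[C]_k) :
  V^t* = V -> (F *m (V *m F^t*))^t* = F *m (V *m F^t*).
Proof. by move=> VV; rewrite !adjmxM adjmxK VV mulmxA. Qed.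

(** * The kernel polynomial of a positive definite block Hankel matrix *)

Section BlockVectors.
Variables (R : realType) (p n : nat) (h : nat -> 'M[R[i]]_p).
Local Notation C := R[i].
Local Notation Re := (@complex.Re R).
Local Notation Im := (@complex.Im R).
Local Notation N := (\sum_(i < n.+1) p)%N.
Local Notation G := (hankel n h).
Implicit Types (x y : 'cV[C]_N) (f g : 'cV[{poly C}]_p).

(** The vector polynomial [F(z) x]. *)
Definition vpoly x : 'cV[{poly C}]_p :=
  \col_a \poly_(j < n.+1) submxcol x (inord j) a 0.

Lemma coef_vpoly x a (j : 'I_n.+1) : (vpoly x a 0)`_j = submxcol x j a 0.
Proof. by rewrite mxE coef_poly ltn_ord inord_val. Qed.

Lemma vsize_vpoly x : vsize_le n.+1 (vpoly x).
Proof. by move=> a; rewrite mxE size_poly. Qed.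

Lemma vpoly_surj f : vsize_le n.+1 f -> exists x, f = vpoly x.
Proof.
move=> fn; exists (\mxcol_j \col_a (f a 0)`_j); apply/colP => a; apply/polyP => k.
rewrite [in RHS]mxE coef_poly; case: ltnP => kn.
  by rewrite mxcolK mxE inordK.
by rewrite nth_default// (leq_trans (fn a)).
Qed.

Lemma vpoly_eq0 x : vpoly x = 0 -> x = 0.
Proof.
move=> x0; apply/mxcolP => j; rewrite submxcol0; apply/colP => a.
by rewrite -coef_vpoly x0 !mxE coef0.
Qed.

Lemma Frow_adj (z : C) :
  (Frow p n z)^t* = \mxcol_(j < n.+1) (z^* ^+ j)%:M :> 'M[C]_(N, p).
Proof.
by apply/matrixP => a b; rewrite !mxE rmorphMn rmorphXn eq_sym.
Qed.

Lemma horner_vpoly x a (z : C) : (vpoly x a 0).[z] = (Frow p n z *m x) a 0.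
Proof.
rewrite -[x in RHS]submxcolK /Frow mul_mxrow_mxcol summxE mxE horner_poly.
apply: eq_bigr => j _; rewrite inord_val mul_scalar_mx [RHS]mxE mulrC.
by [].
Qed.

Lemma hform_vpoly x y : hform h (vpoly x) (vpoly y) = (y^t* *m G *m x) 0 0.
Proof.
rewrite -mulmxA -[x in RHS]submxcolK -[y in RHS]submxcolK /hankel.
rewrite mxblockEv mxcol_mul tr_mxcol.
have -> : map_mx Num.conj (\mxrow_j (submxcol y j)^T) = \mxrow_j (submxcol y j)^t*.
  by apply/matrixP => a b; rewrite !mxE.
rewrite mul_mxrow_mxcol summxE.
under [in RHS]eq_bigr do rewrite mul_mxrow_mxcol mulmx_sumr summxE.
have E a b : momf h (conjp (vpoly y a 0) * vpoly x b 0) a b =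
    \sum_(i < n.+1) \sum_(j < n.+1)
      (submxcol y i a 0)^* * (h (i + j)%N a b * submxcol x j b 0).
  rewrite (@momfM _ _ _ _ _ n.+1 n.+1) ?size_conjp ?vsize_vpoly// summxE.
  apply: eq_bigr => i _; rewrite summxE; apply: eq_bigr => j _.
  by rewrite mxE coef_conjp !coef_vpoly -mulrA [h _ _ _ * _]mulrC.
transitivity (\sum_a \sum_b \sum_(i < n.+1) \sum_(j < n.+1)
    (submxcol y i a 0)^* * (h (i + j)%N a b * submxcol x j b 0)).
  by apply: eq_bigr => a _; apply: eq_bigr => b _; exact: E.
transitivity (\sum_a \sum_(i < n.+1) \sum_b \sum_(j < n.+1)
    (submxcol y i a 0)^* * (h (i + j)%N a b * submxcol x j b 0)).
  by apply: eq_bigr => a _; exact: exchange_big.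
rewrite exchange_big; apply: eq_bigr => i _ /=.
transitivity (\sum_a \sum_(j < n.+1) \sum_b
    (submxcol y i a 0)^* * (h (i + j)%N a b * submxcol x j b 0)).
  by apply: eq_bigr => a _; exact: exchange_big.
rewrite exchange_big; apply: eq_bigr => j _ /=.
rewrite !mxE; apply: eq_bigr => a _; rewrite [(submxcol y i)^t* _ _]mxE.
rewrite [(submxcol y i)^T _ _]mxE [(h _ *m _) _ _]mxE mulr_sumr.
by apply: eq_bigr.
Qed.

Hypothesis G_pos : posdefmx G.

Lemma hankel_herm : G^t* = G.
Proof. by have [/is_hermitianmxP + _] := G_pos; rewrite expr0 scale1r. Qed.

Lemma hankel_entry_herm k : (k <= 2 * n)%N -> (h k)^t* = h k.
Proof.
move=> kn; have i1 : (minn k n < n.+1)%N by rewrite ltnS geq_minr.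
have i2 : (k - minn k n < n.+1)%N by lia.
have E := hankel_herm.
have Hij (i j : 'I_n.+1) : submxblock G i j = h (i + j)%N by rewrite mxblockK.
have kE : k = (Ordinal i1 + Ordinal i2)%N by rewrite /=; lia.
have kE' : k = (Ordinal i2 + Ordinal i1)%N by rewrite /=; lia.
rewrite [in RHS]kE -Hij -{}E {1}kE' -Hij.
by apply/matrixP => a b; rewrite !mxE.
Qed.

Lemma hform_pos f : vsize_le n.+1 f -> f != 0 -> 0 < hform h f f.
Proof.
move=> /vpoly_surj[x ->] x0; rewrite hform_vpoly; apply: G_pos.2.
apply: contraNneq x0 => ->; apply/eqP/colP => a; apply/polyP => k.
by rewrite !mxE coef_poly coef0; case: ifP; rewrite // submxcol0 mxE.
Qed.

Lemma hankel_unit : G \in unitmx.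
Proof.
rewrite -row_free_unit -kermx_eq0; apply/eqP/row_matrixP => i; rewrite row0.
set u := row i _; apply: contraTeq isT => u0.
have uG : u *m G = 0 by apply/sub_kermxP; exact: row_sub.
have /G_pos.2 : u^t* != 0.
  by apply: contraNneq u0 => u0; rewrite -[u]trmxCK u0 trmx0 map_mx0.
by rewrite trmxCK uG mul0mx mxE ltxx.
Qed.

Variable alpha : C.
Hypothesis alpha_gt0 : 0 < Im alpha.

Definition kernel_col : 'M[C]_(N, p) := invmx G *m (Frow p n alpha)^t*.

Definition kernel_coef (j : nat) : 'M[C]_p := submxcol kernel_col (inord j).

Lemma hankel_kernel_coef (i : nat) : (i <= n)%N ->
  \sum_(j < n.+1) h (i + j)%N *m kernel_coef j = (alpha^* ^+ i)%:M.
Proof.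
move=> ni; have : G *m kernel_col = (Frow p n alpha)^t*.
  by rewrite /kernel_col mulKVmx// hankel_unit.
move/(congr1 (fun M => submxcol M (inord i))).
rewrite Frow_adj mxcolK.
rewrite -[kernel_col]submxcolK /hankel mxblockEv mxcol_mul mxcolK.
rewrite mul_mxrow_mxcol inordK// => <-.
by apply: eq_bigr => j _; rewrite /kernel_coef inord_val.
Qed.

(** The matrix polynomial [F(z) Gamma F(alpha)^*]. *)
Definition kernel_poly : 'M[{poly C}]_p :=
  \matrix_(a, b) \poly_(j < n.+1) kernel_coef j a b.

Lemma coef_kernel_poly a b j : (j <= n)%N ->
  (kernel_poly a b)`_j = kernel_coef j a b.
Proof. by move=> jn; rewrite mxE coef_poly ltnS jn. Qed.

Lemma size_kernel_poly a b : (size (kernel_poly a b) <= n.+1)%N.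
Proof. by rewrite mxE size_poly. Qed.

Lemma horner_kernel_poly (z : C) :
  map_mx (horner^~ z) kernel_poly = Frow p n z *m kernel_col.
Proof.
rewrite -[kernel_col in RHS]submxcolK /Frow mul_mxrow_mxcol.
apply/matrixP => a b; rewrite summxE !mxE horner_poly.
apply: eq_bigr => j _; rewrite /kernel_coef inord_val mul_scalar_mx [RHS]mxE.
by rewrite mulrC.
Qed.

(** A linear functional [u T] annihilating the block column
    [Gamma F(alpha)^*] is represented by a vector polynomial that vanishes
    at [alpha]. *)
Lemma kernel_annihilator (T : 'M[C]_(p, N)) (u : 'rV[C]_p) :
  u *m T *m kernel_col = 0 -> u *m T != 0 ->
  exists g, [/\ vsize_le n g, g != 0 &
    forall x, hform h (vpoly x) (('X - alpha%:P) *: g) = (u *m T *m x) 0 0].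
Proof.
move=> uT0 uTN0; pose w := invmx G *m (u *m T)^t*.
have Gu := hankel_unit.
have Gw : w^t* *m G = u *m T.
  by rewrite -{1}hankel_herm -adjmxM /w mulKVmx// adjmxK.
have w0 : vpoly w != 0.
  apply: contraNneq uTN0 => /vpoly_eq0 w0.
  by rewrite -Gw w0 adjmx0 mul0mx.
have wa a : root (vpoly w a 0) alpha.
  rewrite rootE horner_vpoly; apply/eqP.
  have -> : Frow p n alpha *m w = (u *m T *m kernel_col)^t*.
    by rewrite /kernel_col /w !adjmxM !adjmxK adjmx_inv hankel_herm !mulmxA.
  by rewrite uT0 adjmx0 mxE.
pose g : 'cV[{poly C}]_p := \col_a (vpoly w a 0 %/ ('X - alpha%:P)).
have gE : ('X - alpha%:P) *: g = vpoly w.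
  apply/colP => a; rewrite mxE [X in _ * X]mxE mulrC divpK// dvdp_XsubCl.
  exact: wa.
exists g; split.
- move=> a; rewrite mxE size_divp ?polyXsubC_eq0// size_XsubC subn1.
  by have := vsize_vpoly w a; case: (size _).
- by apply: contraNneq w0 => g0; rewrite -gE g0 scaler0.
- by move=> x; rewrite gE hform_vpoly Gw.
Qed.

(** If [u] annihilated the value at [lambda], the polynomial [(z - alpha) g]
    representing [x |-> u F(lambda) x] would be orthogonal to
    [(z - lambda) g]. *)
Lemma kernel_unit (lambda : C) : 0 <= Im lambda ->
  Frow p n lambda *m kernel_col \in unitmx.
Proof.
move=> l0; rewrite -row_free_unit -kermx_eq0.
apply/eqP/row_matrixP => i; rewrite row0; set u := row i _.
apply: contraTeq isT => u0.
have uF : u *m Frow p n lambda *m kernel_col = 0.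
  by rewrite -mulmxA; apply/sub_kermxP; exact: row_sub.
have [|g [gn g0 gE]] := kernel_annihilator uF.
  apply: contraNneq u0 => /(congr1 (fun M => submxrow M ord0)).
  by rewrite /Frow mul_mxrow mxrowK expr0 mulmx1 submxrow0 => ->.
have [x xE] := vpoly_surj (vsize_XsubC lambda gn).
have := hform_XsubC_neq0 hankel_entry_herm hform_pos gn g0 l0 alpha_gt0.
rewrite xE gE -mulmxA mxE big1 ?eqxx// => a _.
by rewrite -horner_vpoly -xE [(_ *: g) _ _]mxE hornerM hornerXsubC subrr mul0r mulr0.
Qed.

(** The analogue of [kernel_unit] at infinity: [T] extracts the coefficient of
    [z^n], which is zero for the polynomial [g] of lower degree. *)
Lemma kernel_coef_unit : kernel_coef n \in unitmx.
Proof.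
pose T : 'M[C]_(p, N) := \mxrow_(j < n.+1) (nat_of_ord j == n)%:R%:M.
have TE q (M : 'M[C]_(N, q)) : T *m M = submxcol M ord_max.
  rewrite -[M in LHS]submxcolK mul_mxrow_mxcol (bigD1 ord_max)//= eqxx mul1mx.
  rewrite big1 ?addr0// => j; rewrite -val_eqE /= => /negPf ->.
  by rewrite raddf0 mul0mx.
have AE : kernel_coef n = T *m kernel_col.
  by rewrite TE /kernel_coef; congr submxcol; apply/val_inj; rewrite /= inordK.
rewrite AE -row_free_unit -kermx_eq0.
apply/eqP/row_matrixP => i; rewrite row0; set u := row i _.
apply: contraTeq isT => u0.
have uF : u *m T *m kernel_col = 0.
  by rewrite -mulmxA; apply/sub_kermxP; exact: row_sub.
have [|g [gn g0 gE]] := kernel_annihilator uF.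
  apply: contraNneq u0 => /(congr1 (fun M => submxrow M ord_max)).
  by rewrite /T mul_mxrow mxrowK eqxx mulmx1 submxrow0 => ->.
have gn1 : vsize_le n.+1 g by move=> a; rewrite (leq_trans (gn a)).
have [x xE] := vpoly_surj gn1.
have := hform_XsubCr_neq0 hankel_entry_herm hform_pos gn g0 alpha_gt0.
rewrite [X in hform _ X]xE gE -mulmxA TE mxE big1 ?eqxx// => a _.
by rewrite -coef_vpoly -xE nth_default ?mulr0 //; exact: gn.
Qed.

End BlockVectors.

(** * Degree of a determinant with polynomial entries *)

Section DeterminantDegree.
Variable K : fieldType.

Lemma coefM_top (P Q : {poly K}) m l : (size P <= m.+1)%N -> (size Q <= l.+1)%N ->
  (P * Q)`_(m + l) = P`_m * Q`_l.
Proof.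
move=> Pm Ql; rewrite coefM.
have ml : (m < (m + l).+1)%N by rewrite ltnS leq_addr.
rewrite (bigD1 (Ordinal ml))//= addKn big1 ?addr0// => j.
rewrite -val_eqE /= => jm; have [jm'|jm'] := ltnP m j.
  by rewrite [P`_j]nth_default ?mul0r// (leq_trans Pm).
by rewrite [Q`__]nth_default ?mulr0// (leq_trans Ql)//; have := ltn_ord j; lia.
Qed.

Lemma prod_top I (s : seq I) (F : I -> {poly K}) n :
  (forall i, (size (F i) <= n.+1)%N) ->
  (size (\prod_(i <- s) F i)%R <= (n * size s).+1)%N /\
  (\prod_(i <- s) F i)`_(n * size s) = \prod_(i <- s) (F i)`_n.
Proof.
move=> Fn; elim: s => [|i s [IH1 IH2]].
  by rewrite !big_nil size_poly1 muln0 coef1.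
rewrite !big_cons /= mulnS; split.
  apply: leq_trans (size_polyMleq _ _) _; have := Fn i.
  move: IH1; move: (size _) (size _) => a b; lia.
by rewrite coefM_top ?Fn// IH2.
Qed.

(** In the Leibniz formula every product has degree at most [n m], and its
    coefficient there is the product of the coefficients in degree [n]. *)
Lemma det_top m n (M : 'M[{poly K}]_m) : (forall i j, (size (M i j) <= n.+1)%N) ->
  (size (\det M)%R <= (n * m).+1)%N /\
  (\det M)`_(n * m) = \det (\matrix_(i, j) (M i j)`_n).
Proof.
move=> Mn; have top (s : {perm 'I_m}) := prod_top (index_enum 'I_m) (fun i => Mn i (s i)).
have cE : size (index_enum 'I_m) = m by rewrite -[RHS]card_ord cardT enumT.
rewrite cE in top; split.
  apply: leq_trans (size_sum _ _ _) _; apply/bigmax_leqP => s _.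
  rewrite -signr_odd; case: (odd _);
  by rewrite ?expr1 ?expr0 ?mulN1r ?mul1r ?size_polyN (top s).1.
rewrite /determinant coef_sum; apply: eq_bigr => s _.
have -> : \prod_i (\matrix_(i, j) (M i j)`_n) i (s i) = \prod_i (M i (s i))`_n.
  by apply: eq_bigr => i _; rewrite mxE.
rewrite -(top s).2; case: (odd_perm s); rewrite ?expr1 ?expr0 ?mulN1r ?mul1r//.
by rewrite coefN.
Qed.

Lemma size_adj m n (M : 'M[{poly K}]_m) i j :
  (forall i j, (size (M i j) <= n.+1)%N) -> (size (\adj M i j) <= (n * m.-1).+1)%N.
Proof.
case: m M i j => [|m] M i j Mn; first by case: i.
rewrite mxE /cofactor -signr_odd.
have [|H _] := @det_top m n (row' j (col' i M)); first by move=> a b; rewrite !mxE.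
by case: (odd _); rewrite ?expr1 ?expr0 ?mulN1r ?mul1r ?size_polyN.
Qed.

End DeterminantDegree.

(** * Moments annihilated by a matrix polynomial *)

Section MomentUniqueness.
Variables (R : realType) (p n : nat).
Local Notation C := R[i].
Local Notation Im := (@complex.Im R).
Variables (D A : nat -> 'M[C]_p).
Hypothesis D_herm : forall k, (k <= 2 * n)%N -> (D k)^t* = D k.
Hypothesis D_ker : forall i, (i <= n)%N -> \sum_(j < n.+1) D (i + j)%N *m A j = 0.
Hypothesis A_unit : A n \in unitmx.

Let Apoly : 'M[{poly C}]_p := \matrix_(a, b) \poly_(j < n.+1) A j a b.

Hypothesis A_lower : lower_roots (\det Apoly).

(** Extends the sequence one step further by solving the annihilation relation
    for its last term. *)
Let step (E : nat -> 'M[C]_p) k : nat -> 'M[C]_p := fun i =>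
  if i == (2 * n + k.+1)%N
  then - (\sum_(j < n) E (n + k.+1 + j)%N *m A j) *m invmx (A n) else E i.

Let ext k : nat -> 'M[C]_p := iteri k (fun k E => step E k) D.

Let E i : 'M[C]_p := ext i i.

Let ext_stable k l i : (i <= 2 * n + k)%N -> ext (l + k) i = ext k i.
Proof.
move=> ik; elim: l => [//|l IH]; rewrite addSn /ext /= -/(ext (l + k)) /step.
by rewrite IH; case: eqP => // ?; lia.
Qed.

Let E_ext k i : (i <= 2 * n + k)%N -> ext k i = E i.
Proof.
move=> ik; rewrite /E; case: (leqP i k) => [le|lt].
  by rewrite -(@ext_stable i (k - i)) ?subnK//; lia.
by rewrite -(@ext_stable k (i - k)) ?subnK//; lia.
Qed.

Let E_D i : (i <= 2 * n)%N -> E i = D i.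
Proof. by move=> i2; rewrite -(@E_ext 0) ?addn0. Qed.

Let E_ker i : \sum_(j < n.+1) E (i + j)%N *m A j = 0.
Proof.
have [ni|ni] := leqP i n.
  rewrite -[RHS](D_ker ni); apply: eq_bigr => j _; rewrite E_D//.
  by have := ltn_ord j; lia.
have iE : i = (n + (i - n.+1).+1)%N by lia.
rewrite big_ord_recr /= {2}iE; set k := (i - n.+1)%N in iE *.
have -> : (n + k.+1 + n = 2 * n + k.+1)%N by lia.
rewrite -(@E_ext k.+1)// /ext /= /step eqxx mulmxKV// -/(ext k).
rewrite [X in X - _](_ : _ = \sum_(j < n) ext k (n + k.+1 + j)%N *m A j) ?subrr//.
by apply: eq_bigr => j _; rewrite E_ext -?iE//; have := ltn_ord j; lia.
Qed.

(** For [i <= n] this is the adjoint of the previous relation; the left-hand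
    sides satisfy the recurrence that [A] defines, so they vanish for all
    [i]. *)
Let E_ker_adj i : \sum_(j < n.+1) (A j)^t* *m E (i + j)%N = 0.
Proof.
elim/ltn_ind: i => i IH; have [ni|ni] := leqP i n.
  transitivity ((\sum_(j < n.+1) D (i + j)%N *m A j)^t*); last first.
    by rewrite D_ker// adjmx0.
  rewrite adjmx_sum; apply: eq_bigr => j _.
  have ij : (i + j <= 2 * n)%N by have := ltn_ord j; lia.
  by rewrite adjmxM D_herm// E_D.
have : \sum_(l < n.+1) (\sum_(j < n.+1) (A j)^t* *m E (i - n + l + j)%N) *m A l = 0.
  under eq_bigr do rewrite mulmx_suml.
  rewrite exchange_big /= big1// => j _.
  transitivity ((A j)^t* *m \sum_(l < n.+1) E (i - n + j + l)%N *m A l).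
    rewrite mulmx_sumr; apply: eq_bigr => l _.
    by rewrite mulmxA addnAC.
  by rewrite E_ker mulmx0.
rewrite big_ord_recr /= big1 ?add0r; last first.
  by move=> l _; rewrite IH ?mul0mx//; have := ltn_ord l; lia.
rewrite subnK; last exact: ltnW.
by move=> /(congr1 (mulmx^~ (invmx (A n)))); rewrite mulmxK// mul0mx.
Qed.

Let momf_ker r a c : \sum_b momf E (r * Apoly b c) a b = 0.
Proof.
have sA b : (size (Apoly b c) <= n.+1)%N by rewrite mxE size_poly.
under eq_bigr => b _ do rewrite (momfM E (leqnn _) (sA b)) summxE.
rewrite exchange_big big1//= => i _.
under eq_bigr => b _ do rewrite summxE.
rewrite exchange_big /=.
transitivity ((r`_i *: \sum_(j < n.+1) E (i + j)%N *m A j) a c).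
  rewrite mxE summxE mulr_sumr; apply: eq_bigr => j _.
  rewrite mxE mulr_sumr; apply: eq_bigr => b _.
  by rewrite !mxE coef_poly ltn_ord -mulrA [A _ _ _ * _]mulrC.
by rewrite E_ker scaler0 mxE.
Qed.

Let momf_ker_adj r a c : \sum_b momf E (r * conjp (Apoly b a)) b c = 0.
Proof.
have sA b : (size (conjp (Apoly b a)) <= n.+1)%N by rewrite size_conjp mxE size_poly.
under eq_bigr => b _ do rewrite (momfM E (leqnn _) (sA b)) summxE.
rewrite exchange_big big1//= => i _.
under eq_bigr => b _ do rewrite summxE.
rewrite exchange_big /=.
transitivity ((r`_i *: \sum_(j < n.+1) (A j)^t* *m E (i + j)%N) a c).
  rewrite mxE summxE mulr_sumr; apply: eq_bigr => j _.
  rewrite mxE mulr_sumr; apply: eq_bigr => b _.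
  by rewrite !mxE coef_conjp coef_poly ltn_ord -mulrA.
by rewrite E_ker_adj scaler0 mxE.
Qed.

(** Multiplying by the adjugate turns annihilation by the matrix polynomial into
    annihilation by its determinant, entry by entry. *)
Let momf_det r : momf E (r * \det Apoly) = 0.
Proof.
apply/matrixP => a e; rewrite mxE.
transitivity (\sum_b momf E (r * (Apoly *m \adj Apoly) b e) a b).
  rewrite (bigD1 e)//= big1 ?addr0 => [|b be].
    by rewrite mul_mx_adj mxE eqxx.
  by rewrite mul_mx_adj mxE (negPf be) mulr0 momf0 mxE.
under eq_bigr => b _.
  rewrite mxE mulr_sumr momf_sum summxE.
  under eq_bigr => c _ do rewrite [Apoly _ _ * _]mulrC mulrA.
  over.
rewrite exchange_big big1//= => c _; exact: momf_ker.
Qed.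

Let momf_det_adj r : momf E (r * conjp (\det Apoly)) = 0.
Proof.
apply/matrixP => e c; rewrite mxE.
transitivity (\sum_b momf E (r * conjp ((Apoly *m \adj Apoly) b e)) b c).
  rewrite (bigD1 e)//= big1 ?addr0 => [|b be].
    by rewrite mul_mx_adj mxE eqxx.
  rewrite mul_mx_adj mxE (negPf be) /conjp map_polyC /=.
  by rewrite rmorph0 mulr0 momf0 mxE.
transitivity (\sum_b \sum_a
    momf E (r * conjp (\adj Apoly a e) * conjp (Apoly b a)) b c).
  apply: eq_bigr => b _; rewrite mxE /conjp rmorph_sum mulr_sumr momf_sum summxE.
  apply: eq_bigr => a _; rewrite rmorphM /= -/(conjp _) -/(conjp _).
  by rewrite [conjp _ * _]mulrC mulrA.
by rewrite exchange_big big1//= => a _; exact: momf_ker_adj.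
Qed.

(** The determinant and its conjugate have their zeros on opposite sides of the
    real axis, so they are coprime, and a functional annihilated by the
    multiples of both is zero. *)
Theorem moments_vanish k : (k <= 2 * n)%N -> D k = 0.
Proof.
move=> kn; rewrite -E_D//.
have cop : coprimep (\det Apoly) (conjp (\det Apoly)).
  rewrite /coprimep; apply/negPn/negP => /closed_rootP[z].
  rewrite root_gcd => /andP[/rootP r1 /rootP r2].
  have z0 : Im z < 0 by rewrite ltNge; apply/negP => /A_lower; rewrite r1 eqxx.
  have : (\det Apoly).[z^*] != 0 by apply: A_lower; rewrite cImJ oppr_ge0 ltW.
  by rewrite -conjC_eq0 -horner_conjp r2 eqxx.
have /Bezout_eq1_coprimepP[[u v] /= uv] := cop.
rewrite -momfXn -[X in momf _ X]mulr1 -uv mulrDr !mulrA momfD.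
by rewrite momf_det momf_det_adj addr0.
Qed.

End MomentUniqueness.

(** * The moments of the density *)

Section MomentsOfDelta.
Variables (R : realType) (p n : nat).
Variable (h : nat -> 'M[R[i]]_p).
Local Notation C := R[i].
Local Notation Re := (@complex.Re R).
Local Notation Im := (@complex.Im R).
Local Notation G := (hankel n h).
Hypothesis G_pos : posdefmx G.
Variable alpha : C.
Hypothesis alpha_gt0 : 0 < Im alpha.
Implicit Types (x : R) (z : C).

Local Notation W := (kernel_col n h alpha).
Local Notation A := (kernel_poly n h alpha).
Local Notation K z := (Frow p n z *m W).
Local Notation d := (\det A).
Local Notation Delta := (DeltaE G alpha).

Lemma horner_det z : d.[z] = \det (K z).
Proof.
rewrite -horner_kernel_poly -[LHS]/(horner_eval z d) -det_map_mx.
by congr (\det _); apply/matrixP => a b; rewrite !mxE.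
Qed.

Lemma det_lower_roots : lower_roots d.
Proof.
by move=> z z0; rewrite horner_det -unitfE -unitmxE; exact: kernel_unit.
Qed.

Lemma size_det : size d = (n * p).+1.
Proof.
have [s1 s2] := det_top (size_kernel_poly n h alpha).
apply/eqP; rewrite eqn_leq s1 ltnNge /=; apply/negP => s3.
have : d`_(n * p) != 0.
  rewrite s2 (_ : \matrix_(i, j) _ = kernel_coef n h alpha n).
    by rewrite -unitfE -unitmxE; exact: kernel_coef_unit.
  by apply/matrixP => a b; rewrite mxE coef_kernel_poly.
by rewrite nth_default ?eqxx.
Qed.

Lemma size_adj_kernel a b : (size (\adj A a b) <= (n * p.-1).+1)%N.
Proof. by apply: size_adj => i j; exact: size_kernel_poly. Qed.

Lemma kernel_inv z a b : 0 <= Im z -> invmx (K z) a b = (\adj A a b).[z] / d.[z].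
Proof.
move=> z0; rewrite /invmx kernel_unit// mxE -horner_det mulrC; congr (_ / _).
rewrite -horner_kernel_poly -[RHS]/(horner_eval z (\adj A a b)).
have -> : map_mx (horner^~ z) A = map_mx (horner_eval z) A by [].
by rewrite -map_mx_adj mxE.
Qed.

Lemma kernel_herm : (K alpha)^t* = K alpha.
Proof. by apply: adjmx_congr; rewrite adjmx_inv hankel_herm. Qed.

Lemma rho_diag : rho alpha alpha = (4 * pi * Im alpha)%:C%C.
Proof.
have sub : alpha - alpha^* = 2 * (Im alpha)%:C%C * 'i := subcJ alpha.
rewrite /rho sub !rmorphM /= rmorph_nat.
have -> : 2 * (pi : R)%:C%C * 'i * (2 * (Im alpha)%:C%C * 'i) =
   4 * (pi : R)%:C%C * (Im alpha)%:C%C * 'i ^+ 2 by ring.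
by rewrite sqrCi mulrN1 opprK.
Qed.

Lemma rho_diag_gt0 : 0 < rho alpha alpha.
Proof.
by rewrite rho_diag -[ltLHS]/(0%:C%C) ltcR !mulr_gt0// pi_gt0.
Qed.

Lemma rho_kernel_pos : posdefmx (rho alpha alpha *: K alpha).
Proof.
split.
  apply/is_hermitianmxP; rewrite expr0 scale1r adjmxZ.
  by rewrite kernel_herm (CrealP (gtr0_real rho_diag_gt0)).
move=> v v0; rewrite -scalemxAr -scalemxAl mxE mulr_gt0 ?rho_diag_gt0//.
pose x := invmx G *m ((Frow p n alpha)^t* *m v).
have Gu := hankel_unit G_pos.
have E : v^t* *m K alpha *m v = x^t* *m G *m x.
  rewrite /x /kernel_col !adjmxM adjmxK adjmx_inv hankel_herm//.
  by rewrite !mulmxA mulmxKV.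
rewrite E; apply: G_pos.2; apply: contraNneq v0 => x0.
have : (Frow p n alpha)^t* *m v = 0 by rewrite -[LHS](mulKVmx Gu) -/x x0 mulmx0.
rewrite Frow_adj mxcol_mul => /(congr1 (fun M => submxcol M ord0)).
by rewrite mxcolK expr0 mul1mx submxcol0 => ->.
Qed.

Lemma EplusE z : Eplus G alpha z =
  rho alpha z *: K z *m mx_rsqrt (rho alpha alpha *: K alpha).
Proof.
have KE y : Frow p n y *m invmx G *m (Frow p n alpha)^t* = K y by rewrite -mulmxA.
by rewrite -!KE.
Qed.

(** The square root enters [Delta] only through its square, the inverse of
    [rho_alpha(alpha) F(alpha) Gamma F(alpha)^*], and the scalar factors combine
    into the Poisson kernel. *)
Lemma DeltaE_eq x :
  Delta x = poisson alpha x *: ((invmx (K x%:C%C))^t* *m K alpha *m invmx (K x%:C%C)).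
Proof.
have Ku : K x%:C%C \in unitmx by apply: kernel_unit.
have [[Sherm _] SS] := mx_rsqrtP rho_kernel_pos.
move: Sherm => /is_hermitianmxP; rewrite expr0 scale1r => Sherm.
rewrite /DeltaE !EplusE; set z := rho alpha x%:C%C.
have zE : z * z^* * poisson alpha x = rho alpha alpha.
  have -> : z^* = 2 * (pi : R)%:C%C * 'i * (x%:C%C - alpha).
    rewrite /z /rho rmorphN !rmorphM /= rmorphB /= conjCK conjCi rmorph_nat.
    by rewrite !conj_Creal ?complex_real// mulrN mulNr opprK.
  have e1 : (Im alpha / pi)%:C%C = (Im alpha)%:C%C / (pi : R)%:C%C.
    by rewrite rmorphM fmorphV.
  have e2 : (4 * pi * Im alpha)%:C%C = 4 * (pi : R)%:C%C * (Im alpha)%:C%C.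
    by rewrite !rmorphM rmorph_nat.
  rewrite /z rho_diag /rho /poisson e1 e2.
  have xa : x%:C%C - alpha != 0 by rewrite real_sub_neq0// gt_eqF.
  have xca : x%:C%C - alpha^* != 0.
    by rewrite real_sub_neq0// cImJ oppr_eq0 gt_eqF.
  have pi0 : (pi : R)%:C%C != 0.
    by rewrite -[0]/(0%:C%C) (inj_eq (@complexI _)) gt_eqF ?pi_gt0.
  move: xa xca pi0 (sqrCi C); move: (x%:C%C - alpha) (x%:C%C - alpha^*) (pi%:C%C).
  move: ('i) ((Im alpha)%:C%C) => j a u v w u0 v0 w0 j2.
  transitivity (- (j ^+ 2) * (4 * w * a)); last by rewrite j2 opprK mul1r.
  by field; rewrite u0 v0 w0.
have r0 : rho alpha alpha != 0 by rewrite gt_eqF ?rho_diag_gt0.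
have Kau : K alpha \in unitmx by apply: kernel_unit => //; exact: ltW.
by rewrite (adjmx_mul_self _ _ Sherm SS) (invmx_sandwich Ku Kau r0 zE).
Qed.

Lemma Delta_herm x : (Delta x)^t* = Delta x.
Proof.
rewrite DeltaE_eq adjmxZ adjmx_sandwich; last exact: kernel_herm.
by rewrite poisson_real.
Qed.

Lemma Delta_ge0 x (v : 'cV[C]_p) :
  0 <= (v^t* *m Delta x *m v) 0 0.
Proof.
rewrite DeltaE_eq -scalemxAr -scalemxAl mxE mulr_ge0 ?(ltW (poisson_gt0 alpha_gt0 x))//.
have [_ pos] := rho_kernel_pos.
move: (K alpha) pos => L pos.
move: (invmx _) => V; rewrite !mulmxA -adjmxM -(mulmxA _ V v).
have [->|w0] := eqVneq (V *m v) 0; first by rewrite mulmx0 mxE.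
have := pos _ w0; rewrite -scalemxAr -scalemxAl mxE pmulr_rgt0; first exact: ltW.
exact: rho_diag_gt0.
Qed.

Definition Delta_den : {poly C} :=
  ('X - alpha%:P) * ('X - (alpha^*)%:P) * (conjp d * d).

Definition Delta_num a b : {poly C} :=
  (Im alpha / pi)%:C%C *: \sum_e \sum_f
    (K alpha) e f *: (conjp (\adj A e a) * \adj A f b).

Lemma Delta_entry x a b :
  Delta x a b = (Delta_num a b).[x%:C%C] / Delta_den.[x%:C%C].
Proof.
have xI : 0 <= Im x%:C%C by [].
have xJ : (x%:C%C)^* = x%:C%C by rewrite conj_Creal// complex_real.
have dx := lower_roots_real x det_lower_roots.
have dcx : (conjp d).[x%:C%C] != 0 by rewrite horner_conjp conjC_eq0 xJ.
have ax : x%:C%C - alpha != 0 by rewrite real_sub_neq0// gt_eqF.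
have acx : x%:C%C - alpha^* != 0.
  by rewrite real_sub_neq0// cImJ oppr_eq0 gt_eqF.
rewrite DeltaE_eq mxE.
have -> : ((invmx (K x%:C%C))^t* *m K alpha *m invmx (K x%:C%C)) a b =
    (\sum_e \sum_f K alpha e f *
      ((conjp (\adj A e a)).[x%:C%C] * (\adj A f b).[x%:C%C])) /
    ((conjp d).[x%:C%C] * d.[x%:C%C]).
  rewrite mxE exchange_big mulr_suml; apply: eq_bigr => f _ /=.
  rewrite mxE !mulr_suml; apply: eq_bigr => e _.
  rewrite [(invmx _)^t* _ _]mxE [(invmx _)^T _ _]mxE !kernel_inv//.
  rewrite rmorphM fmorphV /= -{1 2}xJ -!horner_conjp.
  by field; rewrite dx dcx.
have -> : (Delta_num a b).[x%:C%C] = (Im alpha / pi)%:C%C * \sum_e \sum_f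
    K alpha e f * ((conjp (\adj A e a)).[x%:C%C] * (\adj A f b).[x%:C%C]).
  rewrite hornerZ horner_sum; congr (_ * _); apply: eq_bigr => e _.
  by rewrite horner_sum; apply: eq_bigr => f _; rewrite hornerZ hornerM.
rewrite /Delta_den /poisson !hornerM !hornerXsubC.
move: (\sum_e _) ((Im alpha / pi)%:C%C) => S c.
move: dx dcx ax acx; move: (d.[_]) ((conjp d).[_]) (x%:C%C - alpha) (x%:C%C - alpha^*).
by move=> u v y z u0 v0 y0 z0; field; rewrite u0 v0 y0 z0.
Qed.

Lemma Delta_den_neq0 x : Delta_den.[x%:C%C] != 0.
Proof.
rewrite /Delta_den !hornerM !hornerXsubC !mulf_neq0//.
- by rewrite real_sub_neq0// gt_eqF.
- by rewrite real_sub_neq0// cImJ oppr_eq0 gt_eqF.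
- rewrite horner_conjp conjC_eq0 conj_Creal ?complex_real//.
  exact: lower_roots_real det_lower_roots.
- exact: lower_roots_real det_lower_roots.
Qed.

Lemma size_Delta_den : size Delta_den = (2 * (n * p) + 3)%N.
Proof.
have d0 := lower_roots_neq0 det_lower_roots.
have dc0 : conjp d != 0 by rewrite -size_poly_eq0 size_conjp size_poly_eq0.
rewrite /Delta_den -mulrA size_monicM ?monicXsubC ?mulf_neq0 ?polyXsubC_eq0//.
rewrite size_monicM ?monicXsubC ?mulf_neq0// !size_XsubC.
by rewrite size_mul// size_conjp size_det; lia.
Qed.

Lemma size_Delta_num a b : (size (Delta_num a b) <= 2 * (n * p.-1) + 1)%N.
Proof.
apply: leq_trans (size_scale_leq _ _) _.
apply: leq_trans (size_sum _ _ _) _; apply/bigmax_leqP => e _.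
apply: leq_trans (size_sum _ _ _) _; apply/bigmax_leqP => f _.
apply: leq_trans (size_scale_leq _ _) _; apply: leq_trans (size_polyMleq _ _) _.
have := size_adj_kernel e a; have := size_adj_kernel f b; rewrite size_conjp.
move: (size _) (size _) (n * p.-1)%N => u v w; lia.
Qed.

Lemma Delta_moment_integrable k a b : (k <= 2 * n)%N ->
  cintegrable [set: R] (fun x => (x ^+ k)%:C%C * Delta x a b).
Proof.
move=> kn; have sz : (size ('X^k * Delta_num a b)%R + 2 <= size Delta_den)%N.
  have p0 : (0 < p)%N := leq_ltn_trans (leq0n a) (ltn_ord a).
  have np : (n * p = n * p.-1 + n)%N by rewrite -{1}(prednK p0) mulnS addnC.
  rewrite size_Delta_den np; have := size_Delta_num a b.
  have := size_polyMleq 'X^k (Delta_num a b); rewrite size_polyXn.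
  move: (size _) (size _) (n * p.-1)%N => u v w; lia.
apply: eq_cintegrable (ratio_cintegrable Delta_den_neq0 sz) => // x _.
by rewrite Delta_entry hornerM hornerXn rmorphXn mulrA.
Qed.

Definition Delta_moment k : 'M[C]_p :=
  \matrix_(a, b) cint [set: R] (fun x => (x ^+ k)%:C%C * Delta x a b).

Lemma Delta_moment_herm k : (k <= 2 * n)%N -> (Delta_moment k)^t* = Delta_moment k.
Proof.
move=> kn; apply/matrixP => a b; rewrite !mxE -cint_conj//; last first.
  exact: Delta_moment_integrable.
apply: eq_cint => x _; rewrite rmorphM /= conj_Creal ?complex_real//.
by rewrite -[in RHS]Delta_herm !mxE.
Qed.

(** Multiplied by the kernel on the right, the density loses the factor with
    poles below the axis.  The adjoint of what remains is the Poisson kernel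
    times a function holomorphic above the axis, so its integral is a value at
    [alpha]. *)
Lemma Delta_moment_kernel i : (i <= n)%N ->
  \sum_(j < n.+1) Delta_moment (i + j)%N *m kernel_coef n h alpha j =
  (alpha^* ^+ i)%:M.
Proof.
move=> ni; apply/matrixP => a c; rewrite summxE.
have kij (j : 'I_n.+1) : (i + j <= 2 * n)%N by have := ltn_ord j; lia.
transitivity (cint [set: R] (fun x => (x ^+ i)%:C%C * (Delta x *m K x%:C%C) a c)).
  transitivity (cint [set: R] (fun x => \sum_(j < n.+1) \sum_b
      kernel_coef n h alpha j b c * ((x ^+ (i + j))%:C%C * Delta x a b))).
    have int (j : 'I_n.+1) b := Delta_moment_integrable a b (kij j).
    have intZ (j : 'I_n.+1) b :=
      cintegrableZ (kernel_coef n h alpha j b c) measurableT (int j b).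
    rewrite cint_sum// => [|j]; last exact: cintegrable_sum.
    apply: eq_bigr => j _; rewrite mxE cint_sum//; apply: eq_bigr => b _.
    by rewrite cintZ// mxE mulrC.
  apply: eq_cint => x _; rewrite exchange_big mxE mulr_sumr; apply: eq_bigr => b _.
  rewrite -horner_kernel_poly [map_mx _ _ _ _]mxE [A _ _]mxE horner_poly !mulr_sumr.
  apply: eq_bigr => j _; 
  have -> : (x ^+ (i + j))%:C%C = (x ^+ i)%:C%C * x%:C%C ^+ j.
    by rewrite exprD -rmorphXn -rmorphM.
  by ring.
have H x : (x ^+ i)%:C%C * (Delta x *m K x%:C%C) a c = (\sum_e K alpha c e *
    (poisson alpha x * (('X^i * \adj A e a).[x%:C%C] / d.[x%:C%C])))^*.
  have xI : 0 <= Im x%:C%C by [].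
  have Ku : K x%:C%C \in unitmx by apply: kernel_unit.
  rewrite DeltaE_eq -scalemxAl mulmxKV// mxE mulrCA rmorph_sum mxE /= mulr_sumr mulr_sumr.
  apply: eq_bigr => e _; move: (poisson alpha x) (poisson_real alpha x) => P PR.
  rewrite !rmorphM /= PR -[K alpha in RHS]kernel_herm.
  rewrite [((K alpha)^t*) c e]mxE [(K alpha)^T c e]mxE conjCK.
  rewrite [(invmx _)^t* _ _]mxE [(invmx _)^T _ _]mxE kernel_inv//.
  rewrite hornerM hornerXn -rmorphXn !rmorphM /= [in RHS]conj_Creal ?complex_real//.
  by ring.
have sq e : (size ('X^i * \adj A e a)%R <= size d)%N.
  have p0 : (0 < p)%N := leq_ltn_trans (leq0n a) (ltn_ord a).
  have np : (n * p = n * p.-1 + n)%N by rewrite -{1}(prednK p0) mulnS addnC.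
  rewrite size_det np; have := size_adj_kernel e a.
  have := size_polyMleq 'X^i (\adj A e a); rewrite size_polyXn.
  move: (size _) (size _) (n * p.-1)%N => u v w; lia.
have intP e := (poisson_formula alpha_gt0 det_lower_roots (sq e)).1.
have valP e := (poisson_formula alpha_gt0 det_lower_roots (sq e)).2.
have intZ e := cintegrableZ (K alpha c e) measurableT (intP e).
have intS := cintegrable_sum (index_enum 'I_p) measurableT intZ.
have aI : 0 <= Im alpha := ltW alpha_gt0.
rewrite (@eq_cint R _ _ _ (fun x _ => H x)) cint_conj// cint_sum//.
transitivity ((\sum_e K alpha c e * (alpha ^+ i * invmx (K alpha) e a))^*).
  congr (_^*); apply: eq_bigr => e _; rewrite cintZ// valP hornerM hornerXn.
  by rewrite kernel_inv// !mulrA.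
transitivity ((alpha ^+ i * (K alpha *m invmx (K alpha)) c a)^*).
  congr (_^*); rewrite [(_ *m _) c a]mxE mulr_sumr; apply: eq_bigr => e _.
  by rewrite mulrCA.
rewrite mulmxV; last exact: kernel_unit.
by rewrite !mxE eq_sym mulr_natr rmorphMn rmorphXn.
Qed.

(** Both sequences of moments satisfy the same relation with the coefficients of
    the kernel, so their difference falls under [moments_vanish]. *)
Theorem Delta_moments k : (k <= 2 * n)%N -> Delta_moment k = h k.
Proof.
move=> kn; apply/esym/eqP; rewrite -subr_eq0; apply/eqP.
apply: (@moments_vanish R p n (fun k => h k - Delta_moment k)
  (kernel_coef n h alpha)) => //.
- move=> l ln; rewrite linearB /= map_mxB (hankel_entry_herm G_pos ln).
  by congr (_ - _); exact: Delta_moment_herm.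
- move=> i ni; under eq_bigr do rewrite mulmxBl.
  by rewrite sumrB hankel_kernel_coef// Delta_moment_kernel// subrr.
- exact: kernel_coef_unit.
- exact: det_lower_roots.
Qed.

End MomentsOfDelta.

(** * Riemann-Stieltjes sums against an absolutely continuous function *)

Section StieltjesSums.
Variable R : realType.
Local Notation mu := (@lebesgue_measure R).
Implicit Types (phi f Phi : R -> R) (a b x : R).

Lemma integrable_mulr (D : set (measurableTypeR R)) c phi : measurable D ->
  mu.-integrable D (EFin \o phi) -> mu.-integrable D (EFin \o (fun x => c * phi x)).
Proof.
by move=> mD i; apply: (eq_integrable mD _ _ _ (integrableZl mD c i)).
Qed.

Lemma Rintegral_itvD phi a b c : a <= b -> b <= c ->
  mu.-integrable [set: R] (EFin \o phi) ->
  Rintegral mu `]a, c] phi = Rintegral mu `]a, b] phi + Rintegral mu `]b, c] phi.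
Proof.
move=> ab bc iphi; apply/eqP; rewrite addrC -subr_eq; apply/eqP.
apply: Rintegral_itvB; rewrite ?bnd_simp//.
exact: integrableS iphi.
Qed.

Lemma Rintegral_ray phi a b : a <= b -> mu.-integrable [set: R] (EFin \o phi) ->
  Rintegral mu `]-oo, b] phi - Rintegral mu `]-oo, a] phi =
  Rintegral mu `]a, b] phi.
Proof.
move=> ab iphi; apply: Rintegral_itvB; rewrite ?bnd_simp//.
exact: integrableS iphi.
Qed.

(** On each interval of the partition the integrand and its value at the tag
    differ by at most [eta]. *)
Lemma stieltjes_sum_bound phi f (eta : R) : 0 <= eta ->
  mu.-integrable [set: R] (EFin \o phi) ->
  mu.-integrable [set: R] (EFin \o (fun x => f x * phi x)) ->
  forall (s : seq R) a (t : nat -> R), path <%O a s ->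
  (forall k x, (k < size s)%N -> (a :: s)`_k <= x <= s`_k ->
     `|f (t k) - f x| <= eta) ->
  `| \sum_(k < size s) f (t k) * (Rintegral mu `]-oo, s`_k] phi -
       Rintegral mu `]-oo, (a :: s)`_k] phi)
     - Rintegral mu `]a, last a s] (fun x => f x * phi x)|
  <= eta * Rintegral mu `]a, last a s] (fun x => `|phi x|).
Proof.
move=> eta0 iphi ifphi.
have inphi : mu.-integrable [set: R] (EFin \o (fun x => `|phi x|)).
  exact: integrable_norm.
elim=> [|y s IH] a t /= => [_ _|/andP[ay ys] ht].
  by rewrite big_ord0 set_itv_ge ?bnd_simp ?ltxx// !Rintegral_set0 mulr0 subr0 normr0.
have yl : y <= last y s.
  by apply: (@itv_partition_le _ _ y _ s); split.
rewrite big_ord_recl /= !(@Rintegral_itvD _ a y (last y s))// ?(ltW ay)//.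
rewrite Rintegral_ray ?(ltW ay)// mulrDr opprD addrACA.
apply: le_trans (ler_normD _ _) _; apply: lerD; last first.
  by apply: (IH y (fun k => t k.+1) ys) => k x ks; exact: (ht k.+1).
have iay g : mu.-integrable [set: R] (EFin \o g) -> mu.-integrable `]a, y] (EFin \o g).
  by move=> ig; apply: integrableS ig.
have m : measurable (`]a, y] : set (measurableTypeR R)) by [].
have i1 : mu.-integrable `]a, y] (EFin \o (fun x => f (t 0%N) * phi x)).
  by apply: integrable_mulr => //; exact: iay.
have i2 := iay _ ifphi.
have i3 : mu.-integrable `]a, y]
    (EFin \o (fun x => f (t 0%N) * phi x - f x * phi x)).
  by apply: (eq_integrable m _ _ _ (integrableB m i1 i2)).
have i4 : mu.-integrable `]a, y] (EFin \o (fun x => eta * `|phi x|)).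
  by apply: integrable_mulr => //; exact: iay.
rewrite -RintegralZl ?iay// -RintegralB//.
apply: le_trans (le_normr_Rintegral m i3) _.
rewrite -RintegralZl ?iay//; apply: le_Rintegral => //.
  exact: integrable_norm.
move=> x; rewrite /= in_itv /= => /andP[ax xy].
rewrite -mulrBl normrM ler_wpM2r//; apply: (ht 0%N) => //=.
by rewrite (ltW ax) xy.
Qed.

Lemma Rintegral_ge0_subset (A B : set (measurableTypeR R)) Phi :
  measurable A -> measurable B -> A `<=` B -> (forall x, 0 <= Phi x) ->
  mu.-integrable B (EFin \o Phi) ->
  Rintegral mu A Phi <= Rintegral mu B Phi.
Proof.
move=> mA mB AB P0 iB; rewrite /Rintegral fine_le//.
- by apply: integrable_fin_num => //; exact: integrableS iB.
- exact: integrable_fin_num.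
- apply: ge0_subset_integral => //; first exact: (measurable_int mu).
  by move=> x _; rewrite lee_fin.
Qed.

(** A tail of a dominating integral bounds the tails of all the integrals it
    dominates, uniformly. *)
Lemma Rintegral_tail Phi : mu.-integrable [set: R] (EFin \o Phi) ->
  forall e : R, 0 < e -> exists N : R, forall phi a b,
    mu.-integrable [set: R] (EFin \o phi) -> (forall x, `|phi x| <= Phi x) ->
    a < - N -> N < b -> a < b ->
    `|Rintegral mu `]a, b] phi - Rintegral mu [set: R] phi| < e.
Proof.
move=> iPhi e e0.
have /cvgrPdist_lt/(_ e e0)[N _ /(_ N (leqnn N)) HN] := Rintegral_sym_cvg iPhi.
exists N%:R => phi a b iphi le aN Nb ab.
set D : set (measurableTypeR R) := `]a, b].
have mD : measurable D by exact: measurable_itv.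
have mDc : measurable (~` D) by apply: measurableC.
have split_D g : mu.-integrable [set: R] (EFin \o g) ->
    Rintegral mu [set: R] g = Rintegral mu D g + Rintegral mu (~` D) g.
  move=> ig; rewrite -(setUv D) Rintegral_setU// ?setUv//.
  by apply/disj_setPS; rewrite setICr.
have iDc g : mu.-integrable [set: R] (EFin \o g) -> mu.-integrable (~` D) (EFin \o g).
  by move=> ig; apply: integrableS ig.
rewrite (split_D _ iphi) opprD addNKr normrN.
apply: le_lt_trans (le_normr_Rintegral mDc (iDc _ iphi)) _.
apply: (@le_lt_trans _ _ (Rintegral mu (~` D) Phi)).
  apply: le_Rintegral => //; last exact: iDc.
  by apply: integrable_norm; exact: iDc.
apply: le_lt_trans HN; rewrite (split_D _ iPhi) -addrA addrCA.
apply: le_trans (ler_norm _); rewrite lerDl subr_ge0.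
apply: Rintegral_ge0_subset => //.
- move=> x; rewrite /D /= !in_itv /= => /andP[x1 x2].
  by rewrite (lt_le_trans aN x1) (le_trans x2 (ltW Nb)).
- by move=> x; apply: le_trans (le x).
- exact: integrableS iPhi.
Qed.

Lemma exprn_lipschitz (k : nat) (M x y : R) : `|x| <= M -> `|y| <= M -> 1 <= M ->
  `|x ^+ k - y ^+ k| <= k%:R * M ^+ k * `|x - y|.
Proof.
move=> xM yM M1; have M0 : 0 <= M by rewrite (le_trans ler01).
elim: k => [|k IH]; first by rewrite !expr0 subrr normr0 !mul0r.
have -> : x ^+ k.+1 - y ^+ k.+1 = x * (x ^+ k - y ^+ k) + (x - y) * y ^+ k.
  by rewrite !exprS; ring.
apply: le_trans (ler_normD _ _) _; rewrite !normrM normrX.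
have -> : k.+1%:R * M ^+ k.+1 * `|x - y| =
    M * (k%:R * M ^+ k * `|x - y|) + `|x - y| * M ^+ k.+1.
  by rewrite -natr1 exprS; ring.
apply: lerD; first by rewrite ler_pM// mulr_ge0.
rewrite ler_wpM2l// (@le_trans _ _ (M ^+ k))//; last by rewrite ler_weXn2l.
by rewrite lerXn2r// nnegrE.
Qed.

End StieltjesSums.

(** * A positive density with given moments solves the moment problem *)

Section DensitySolution.
Variables (R : realType) (p n : nat) (h : nat -> 'M[R[i]]_p).
Variable F : R -> 'M[R[i]]_p.
Local Notation mu := (@lebesgue_measure R).
Local Notation C := R[i].
Local Notation Re := (@complex.Re R).
Local Notation Im := (@complex.Im R).
Implicit Types (x : R) (k : nat).

Let moment k i j x : C := (x ^+ k)%:C%C * F x i j.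

Hypothesis F_integrable : forall k i j, (k <= 2 * n)%N ->
  cintegrable [set: R] (moment k i j).
Hypothesis F_moments : forall k i j, (k <= 2 * n)%N ->
  cint [set: R] (moment k i j) = h k i j.
Hypothesis F_herm : forall x, (F x)^t* = F x.
Hypothesis F_ge0 : forall x (v : 'cV[C]_p), 0 <= (v^t* *m F x *m v) 0 0.

Let sigma x : 'M[C]_p := mx_integral `]-oo, x] F.

Lemma normc_le_Re_Im (z : C) : `|z| <= (`|Re z| + `|Im z|)%:C%C.
Proof.
rewrite normcE_Re_Im lecR -[leRHS]ger0_norm ?addr_ge0// -sqrtr_sqr ler_wsqrtr//.
rewrite sqrrD !real_normK ?num_real// -addrA lerD2l lerDr.
by rewrite mulrn_wge0// mulr_ge0.
Qed.

Lemma cReZ (c : R) (z : C) : Re (c%:C%C * z) = c * Re z.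
Proof. by rewrite cReM /= mul0r subr0. Qed.

Lemma cImZ (c : R) (z : C) : Im (c%:C%C * z) = c * Im z.
Proof. by rewrite cImM /= mul0r addr0. Qed.

Lemma Re_sum J (s : seq J) (g : J -> C) : Re (\sum_(j <- s) g j) = \sum_(j <- s) Re (g j).
Proof. by apply: (big_morph Re) => // z w; rewrite cReD. Qed.

Lemma Im_sum J (s : seq J) (g : J -> C) : Im (\sum_(j <- s) g j) = \sum_(j <- s) Im (g j).
Proof. by apply: (big_morph Im) => // z w; rewrite cImD. Qed.

Let F_int i j : cintegrable [set: R] (fun x => F x i j).
Proof.
apply: eq_cintegrable (F_integrable i j (leq0n _)) => // x _.
by rewrite /moment expr0 mul1r.
Qed.

Let sigmaB a b : a <= b ->
  sigma b - sigma a = \matrix_(i, j) cint `]a, b] (fun x => F x i j).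
Proof.
move=> ab; apply/matrixP => i j; rewrite !mxE.
have [i1 i2] := F_int i j.
by apply: ReImP => /=; rewrite ?cReD ?cImD /= Rintegral_ray.
Qed.

Lemma density_nondecreasing : mx_nondecreasing sigma.
Proof.
move=> a b ab; rewrite sigmaB//.
have mab : measurable (`]a, b] : set (measurableTypeR R)) by exact: measurable_itv.
have Fab i j : cintegrable `]a, b] (fun x => F x i j).
  by apply: cintegrableS (F_int i j).
split.
  apply/is_hermitianmxP; rewrite expr0 scale1r; apply/matrixP => i j; rewrite !mxE.
  rewrite -cint_conj//; apply: eq_cint => x _.
  by rewrite -[in LHS]F_herm !mxE.
move=> v; rewrite (_ : _ 0 0 = cint `]a, b] (fun x => (v^t* *m F x *m v) 0 0)).
  by apply: cint_ge0 => x _; exact: F_ge0.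
transitivity (\sum_j \sum_i (v i 0)^* * v j 0 * cint `]a, b] (fun x => F x i j)).
  rewrite mxE; apply: eq_bigr => j _; rewrite mxE mulr_suml; apply: eq_bigr => i _.
  by rewrite !mxE mulrAC.
have Z i j := cintegrableZ ((v i 0)^* * v j 0) mab (Fab i j).
transitivity (cint `]a, b] (fun x => \sum_j \sum_i (v i 0)^* * v j 0 * F x i j)).
  rewrite cint_sum// => [|j]; last by apply: cintegrable_sum.
  apply: eq_bigr => j _; rewrite cint_sum//; apply: eq_bigr => i _.
  by rewrite cintZ.
apply: eq_cint => x _; rewrite mxE; apply: eq_bigr => j _.
rewrite mxE mulr_suml; apply: eq_bigr => i _.
by rewrite !mxE mulrAC.
Qed.

(** A single real function dominating all the components of a family of
    matrix entries gives bounds that are uniform in the entry. *)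
Let dom (k : nat) x : R :=
  \sum_i \sum_j (`|Re (moment k i j x)| + `|Im (moment k i j x)|).

Let le_dom k i j x : `|Re (moment k i j x)| + `|Im (moment k i j x)| <= dom k x.
Proof.
rewrite /dom (bigD1 i)//= (bigD1 j)//= -addrA lerDl addr_ge0//.
  by apply: sumr_ge0.
by apply: sumr_ge0 => i' _; apply: sumr_ge0.
Qed.

Let dom_integrable k : (k <= 2 * n)%N -> mu.-integrable [set: R] (EFin \o dom k).
Proof.
move=> kn.
have sum_int (J : Type) (s : seq J) (g : J -> R -> R) :
    (forall i, mu.-integrable [set: R] (EFin \o g i)) ->
    mu.-integrable [set: R] (EFin \o (fun x => \sum_(i <- s) g i x)).
  move=> ig; elim: s => [|i s IH].
    apply: (eq_integrable measurableT _ _ _ (integrable0 _ _)) => x _.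
    by rewrite /= big_nil.
  apply: (eq_integrable measurableT _ _ _ (integrableD measurableT (ig i) IH)).
  by move=> x _; rewrite /= big_cons.
apply: (sum_int) => i; apply: (sum_int) => j; have [i1 i2] := F_integrable i j kn.
by apply: (eq_integrable measurableT _ _ _
  (integrableD measurableT (integrable_norm i1) (integrable_norm i2))).
Qed.

Let I k a b : 'M[C]_p := \matrix_(i, j) cint `]a, b] (moment k i j).

Lemma density_rs_integral k a b : (k <= 2 * n)%N -> a < b ->
  is_rs_integral (fun x => x ^+ k) sigma a b (I k a b).
Proof.
move=> kn ab e e0.
pose V := Rintegral mu [set: R] (dom 0).
have V0 : 0 <= V by apply: Rintegral_ge0 => x _; apply: sumr_ge0 => i _; apply: sumr_ge0.
pose M : R := 1 + `|a| + `|b|.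
have M1 : 1 <= M by rewrite /M -addrA lerDl addr_ge0.
have M0 : 0 < M by apply: lt_le_trans M1.
(* The real and imaginary parts of an entry each have total mass at most [V],
   and [2 V eta < e]. *)
pose eta : R := e / (2 * V + 1).
have W0 : 0 < 2 * V + 1 by rewrite ltr_wpDl// mulr_ge0.
have eta0 : 0 < eta by rewrite divr_gt0.
have D0 : 0 < k%:R * M ^+ k + 1 by rewrite ltr_wpDl// mulr_ge0// exprn_ge0// ltW.
exists (eta / (k%:R * M ^+ k + 1)); first by rewrite divr_gt0.
move=> s t sp mesh i j.
have [path_s /eqP last_s] := sp.
have inM x : a <= x <= b -> `|x| <= M.
  move=> /andP[ax xb]; rewrite ler_norml /M; apply/andP; split.
    have := ler_normr a (- a); have := normr_ge0 b; have := normr_ge0 a.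
    by have := ler_norm (- a); rewrite normrN; lra.
  by have := ler_norm b; have := normr_ge0 a; lra.
have close l x : (l < size s)%N -> (a :: s)`_l <= x <= s`_l ->
    `|t l ^+ k - x ^+ k| <= eta.
  move=> ls /andP[lx xl]; have [sd /andP[lt tl]] := mesh l ls.
  have al : a <= (a :: s)`_l.
    by rewrite (set_nth_default b) ?(itv_partition_nth_ge _ sp)// ltnS ltnW.
  have lb : s`_l <= b.
    have := @itv_partition_nth_le _ _ _ _ _ l.+1 _ sp.
    by rewrite /= (set_nth_default 0)//; exact.
  have tM : `|t l| <= M by apply: inM; rewrite (le_trans al lt) (le_trans tl lb).
  have xM : `|x| <= M by apply: inM; rewrite (le_trans al lx) (le_trans xl lb).
  apply: le_trans (exprn_lipschitz k tM xM M1) _.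
  have tx : `|t l - x| <= eta / (k%:R * M ^+ k + 1).
    by apply: le_trans (ltW sd); rewrite ler_norml; apply/andP; split; lra.
  apply: le_trans (ler_wpM2l _ tx) _; first by rewrite mulr_ge0// exprn_ge0// ltW.
  rewrite mulrCA ler_piMr ?(ltW eta0)// ler_pdivrMr// mul1r lerDl.
  by [].
have [i1 i2] := F_int i j; have [k1 k2] := F_integrable i j kn.
have kE1 : mu.-integrable [set: R] (EFin \o (fun x => x ^+ k * Re (F x i j))).
  by apply: (eq_integrable measurableT _ _ _ k1) => x _; rewrite /moment /= cReZ.
have kE2 : mu.-integrable [set: R] (EFin \o (fun x => x ^+ k * Im (F x i j))).
  by apply: (eq_integrable measurableT _ _ _ k2) => x _; rewrite /moment /= cImZ.
have B1 := stieltjes_sum_bound (ltW eta0) i1 kE1 path_s close.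
have B2 := stieltjes_sum_bound (ltW eta0) i2 kE2 path_s close.
rewrite last_s in B1 B2.
apply: le_lt_trans (normc_le_Re_Im _) _; rewrite ltcR.
have ReE : Re (rs_sum (fun x => x ^+ k) sigma a s t i j - I k a b i j) =
    \sum_(l < size s) t l ^+ k * (Rintegral mu `]-oo, s`_l] (fun x => Re (F x i j)) -
       Rintegral mu `]-oo, (a :: s)`_l] (fun x => Re (F x i j)))
     - Rintegral mu `]a, b] (fun x => x ^+ k * Re (F x i j)).
  rewrite !mxE cReD /rs_sum summxE Re_sum; congr (_ + _).
    by apply: eq_bigr => l _; rewrite !mxE cReZ.
  by rewrite /=; congr (- _); apply: eq_Rintegral => x _; rewrite /moment cReZ.
have ImE : Im (rs_sum (fun x => x ^+ k) sigma a s t i j - I k a b i j) =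
    \sum_(l < size s) t l ^+ k * (Rintegral mu `]-oo, s`_l] (fun x => Im (F x i j)) -
       Rintegral mu `]-oo, (a :: s)`_l] (fun x => Im (F x i j)))
     - Rintegral mu `]a, b] (fun x => x ^+ k * Im (F x i j)).
  rewrite !mxE cImD /rs_sum summxE Im_sum; congr (_ + _).
    by apply: eq_bigr => l _; rewrite !mxE cImZ.
  by rewrite /=; congr (- _); apply: eq_Rintegral => x _; rewrite /moment cImZ.
rewrite ReE ImE; apply: le_lt_trans (lerD B1 B2) _.
have mab : measurable (`]a, b] : set (measurableTypeR R)) by exact: measurable_itv.
have iab g : mu.-integrable [set: R] (EFin \o g) -> mu.-integrable `]a, b] (EFin \o g).
  by move=> ig; apply: integrableS ig.
have idom := dom_integrable (leq0n (2 * n)).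
have leV g : mu.-integrable [set: R] (EFin \o g) -> (forall x, `|g x| <= dom 0 x) ->
    Rintegral mu `]a, b] (fun x => `|g x|) <= V.
  move=> ig gdom; apply: (@le_trans _ _ (Rintegral mu `]a, b] (dom 0))).
    by apply: le_Rintegral => //; [exact/integrable_norm/iab|exact: iab].
  by apply: Rintegral_ge0_subset => // x; apply: le_trans (gdom x).
have F0 x : moment 0 i j x = F x i j by rewrite /moment expr0 mul1r.
have L1 := leV _ i1 (fun x => _ : `|Re (F x i j)| <= dom 0 x).
have L2 := leV _ i2 (fun x => _ : `|Im (F x i j)| <= dom 0 x).
rewrite -mulrDr; apply: (@le_lt_trans _ _ (eta * (V + V))).
  rewrite ler_pM2l// lerD ?L1 ?L2// => x; apply: le_trans (le_dom 0 i j x); rewrite F0.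
    by rewrite lerDl.
  by rewrite lerDr.
by rewrite /eta mulrAC ltr_pdivrMr// ltr_pM2l//; lra.
Qed.

Lemma density_rs_integral_line k : (k <= 2 * n)%N ->
  is_rs_integral_line (fun x => x ^+ k) sigma (h k).
Proof.
move=> kn; exists (I k); split; first by move=> a b; exact: density_rs_integral.
move=> e e0; have e20 : 0 < e / 2 by rewrite divr_gt0.
have [N HN] := Rintegral_tail (dom_integrable kn) e20.
exists N => a b aN Nb ab i j; have [k1 k2] := F_integrable i j kn.
apply: le_lt_trans (normc_le_Re_Im _) _; rewrite ltcR [e]splitr.
rewrite mxE -(F_moments i j kn) cReD cImD /=.
apply: ltrD; apply: HN => //= x; apply: le_trans (le_dom k i j x).
  by rewrite lerDl.
by rewrite lerDr.
Qed.

Theorem density_hamburger_solution : hamburger_solution n h sigma.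
Proof.
by split; [exact: density_nondecreasing|exact: density_rs_integral_line].
Qed.

End DensitySolution.

(** * Solution of the truncated moment problem *)

Theorem corollary4p4 (R : realType) (p n : nat) (h : nat -> 'M[R[i]]_p)
    (alpha : R[i]) :
  (0 < p)%N -> (0 < n)%N ->
  posdefmx (hankel n h) ->
  0 < complex.Im alpha ->
  let Delta := DeltaE (hankel n h) alpha in
  (forall k, (k <= 2 * n)%N ->
     mx_integrable [set: R] (fun mu : R => (mu ^+ k)%:C%C *: Delta mu) /\
     mx_integral [set: R] (fun mu : R => (mu ^+ k)%:C%C *: Delta mu) = h k) /\
  hamburger_solution n h (fun mu : R => mx_integral `]-oo, mu] Delta).
Proof.
move=> _ _ G_pos alpha_gt0 Delta.
have int k i j (kn : (k <= 2 * n)%N) :=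
  Delta_moment_integrable G_pos alpha_gt0 i j kn.
have mom k i j : (k <= 2 * n)%N ->
    cint [set: R] (fun x => (x ^+ k)%:C%C * Delta x i j) = h k i j.
  by move=> kn; rewrite -(Delta_moments G_pos alpha_gt0 kn) mxE.
split; last first.
  apply: density_hamburger_solution => //.
  - exact: Delta_herm.
  - exact: Delta_ge0.
move=> k kn; have entry i j x : ((x ^+ k)%:C%C *: Delta x) i j =
    (x ^+ k)%:C%C * Delta x i j by rewrite mxE.
split; first by move=> i j; apply: eq_cintegrable (int k i j kn).
by apply/matrixP => i j; rewrite mxE -(mom k i j kn); apply: eq_cint.
Qed.
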